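(* Assume that $\mathbb K=\mathbb C$. Let $\mathbf E$ be a Banach space with a normalized $1$-unconditional basis $(\mathbf e_i)_{i\in\mathbb N}$. Assume that $(\mathbf e_i)$ is strictly $1$-unconditional, and that $\mathrm{span}(\mathbf e_j,\mathbf e_k)$ is not isometrically equal to $\ell_2(2)$ for any $j\neq k$. Let $\mathcal F_1$ and $\mathcal F_2$ be two combinatorial families. Then any isometry $J:X_{\mathcal F_1,\mathbf E}\to X_{\mathcal F_2,\mathbf E}$ is an $(\mathcal F_1,\mathcal F_2)$-compatible signed permutation of $(e_i)$. If moreover $(\mathbf e_i)$ is $1$-symmetric and either $\mathcal F_1$ and $\mathcal F_2$ are compact or $(\mathbf e_i)$ is shrinking, then any isometry $J:X_{\mathcal F_1,\mathbf E}^*\to X_{\mathcal F_2,\mathbf E}^*$ is an $(\mathcal F_1,\mathcal F_2)$-compatible signed permutation of $(e_i^* )$.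
   Context: $\mathbb N=\{1,2,\dots\}$; ''isometry'' means linear surjective isometry; a sign is a scalar of modulus $1$. The basis $(\mathbf e_i)$ is strictly $1$-unconditional if whenever $(a_i),(b_i)\in c_{00}$ satisfy $|a_i|\leqslant|b_i|$ for all $i$ with at least one strict inequality, then $\|\sum a_i\mathbf e_i\|_{\mathbf E}<\|\sum b_i\mathbf e_i\|_{\mathbf E}$. It is $1$-symmetric if every permutation $\pi$ of $\mathbb N$ induces a well-defined isometry of $\mathbf E$ ($\mathbf e_i\mapsto\mathbf e_{\pi(i)}$). It is shrinking if the coordinate functionals $(\mathbf e_i^* )$ form a basis of $\mathbf E^*$. For vectors $u,v$ of a normed space, $\mathrm{span}(u,v)$ is isometrically equal to $\ell_2(2)$ if $\|au+bv\|^2=|a|^2+|b|^2$ for all scalars $a,b$. A combinatorial family is a family $\mathcal F$ of finite subsets of $\mathbb N$ containing all singletons and hereditary for inclusion; it is compact if closed in $\{0,1\}^{\mathbb N}$. $c_{00}$ is the space of finitely supported scalar sequences with canonical basis $(e_i)$. $X_{\mathcal F,\mathbf E}$ is the completion of $c_{00}$ for the norm $\|x\|_{\mathcal F,\mathbf E}=\sup\{\|\sum_{i\in F}x(i)\mathbf e_i\|_{\mathbf E};F\in\mathcal F\}$; $(e_i)$ is a $1$-unconditional basis of it, with coordinate functionals $(e_i^* )$; $(e_i^* )$ is a basis of $X_{\mathcal F,\mathbf E}^*$ if $\mathcal F$ is compact or $(\mathbf e_i)$ is shrinking. $J$ is an $(\mathcal F_1,\mathcal F_2)$-compatible signed permutation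 of $(e_i)$ (resp. $(e_i^* )$) if there are signs $(\omega_i)$ and a permutation $\pi$ of $\mathbb N$ with $\pi(\mathcal F_1):=\{\pi(F);F\in\mathcal F_1\}=\mathcal F_2$ such that $Je_i=\omega_ie_{\pi(i)}$ (resp. $Je_i^*=\omega_ie_{\pi(i)}^*$) for all $i$. *)

(* Defs.v *)
From HB Require Import structures.
From mathcomp Require Import all_boot all_order all_algebra.
From mathcomp Require Import finmap complex.
From mathcomp Require Import all_classical all_reals all_analysis.

Set Implicit Arguments.
Unset Strict Implicit.
Unset Printing Implicit Defensive.

Import Order.TTheory GRing.Theory Num.Theory.
Import numFieldTopology.Exports numFieldNormedType.Exports.

Local Open Scope classical_set_scope.
Local Open Scope ring_scope.
Local Open Scope complex_scope.

(* A norm on a [normedModType R[i]] takes its values in R[i]; suprema are taken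
   in R through [complex.Re] and sent back to R[i] by [_%:C]. *)

Section Dual.
Variables (R : realType) (V : normedModType R[i]).

Definition is_dual : pred (V -> R[i]^o) :=
  fun f => `[< linear f /\ continuous f >].

Record dual_space :=
  Dual { dual_fun :> V -> R[i]^o; dualP : dual_fun \in is_dual }.

HB.instance Definition _ := [isSub for dual_fun].
HB.instance Definition _ := gen_eqMixin dual_space.
HB.instance Definition _ := gen_choiceMixin dual_space.

Fact is_dual_submod_closed : submod_closed is_dual.
Proof.
split.
  apply/asboolP; split; last by move=> x; exact: cvg_cst.
  by move=> a x y; rewrite scaler0 addr0.
move=> a f g /asboolP[lf cf] /asboolP[lg cg]; apply/asboolP; split.
  move=> b x y.
  have E (z : V) : (a *: f + g) z = a *: f z + g z by [].
  by rewrite !E lf lg !scalerDr !scalerA (mulrC a b) addrACA.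
by move=> x; apply: cvgD; [apply: cvgZr; exact: cf|exact: cg].
Qed.

HB.instance Definition _ :=
  GRing.isSubmodClosed.Build R[i] (V -> R[i]^o) is_dual is_dual_submod_closed.
HB.instance Definition _ := [SubChoice_isSubLmodule of dual_space by <:].

Fact dual_linear (f : dual_space) : linear f.
Proof. by case: f => f /= /asboolP[]. Qed.

Fact dual_continuous (f : dual_space) : continuous f.
Proof. by case: f => f /= /asboolP[]. Qed.

HB.instance Definition _ (f : dual_space) :=
  GRing.isLinear.Build R[i] V R[i]^o *:%R f (@dual_linear f).

Definition dual_norm (f : dual_space) : R[i] :=
  (sup [set complex.Re `|f x| | x in [set x : V | `|x| <= 1]])%:C.

Implicit Types f g : dual_space.

Lemma Re_normK (W : normedModType R[i]) (x : W) : (complex.Re `|x|)%:C = `|x|.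
Proof. by apply: RRe_real; apply: normr_real. Qed.

Lemma dual_has_sup f :
  has_sup [set complex.Re `|f x| | x in [set x : V | `|x| <= 1]].
Proof.
split; first by exists (complex.Re `|f 0|), 0 => //=; rewrite normr0.
have := @continuous_linear_bounded _ _ _ (0 : V) f (@dual_continuous f 0).
move=> /linear_boundedP [M [Mr HM]].
have M1 : M < `|M| + 1 by rewrite (le_lt_trans (real_ler_norm Mr))// ltrDl.
exists (complex.Re (`|M| + 1)) => _ [x /= x1 <-].
have := HM _ M1 x => h.
have : `|f x| <= `|M| + 1.
  by apply: (le_trans h); rewrite -[leRHS]mulr1 ler_wpM2l// addr_ge0.
by rewrite lecE => /andP[].
Qed.

Lemma dual_norm_ub f x : `|x| <= 1 -> `|f x| <= dual_norm f.
Proof.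
move=> x1; rewrite -Re_normK lecR.
by apply: ub_le_sup; [case: (dual_has_sup f)|exists x].
Qed.

Lemma dual_norm_le f (M : R[i]) :
  (forall x, `|x| <= 1 -> `|f x| <= M) -> dual_norm f <= M.
Proof.
move=> H; have M0 : 0 <= M.
  by apply: (le_trans (normr_ge0 (f 0))); apply: H; rewrite normr0.
rewrite -(RRe_real (ger0_real M0)) lecR.
apply: ge_sup; first by case: (dual_has_sup f).
move=> _ [x /= x1 <-].
by have := H x x1; rewrite lecE => /andP[].
Qed.

Lemma dual_norm_ge0 f : 0 <= dual_norm f.
Proof. by apply: le_trans (dual_norm_ub f (x := 0) _); rewrite ?normr0. Qed.

Fact dual_ler_normD f g : dual_norm (f + g) <= dual_norm f + dual_norm g.
Proof.
apply: dual_norm_le => x x1.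
by rewrite (le_trans (ler_normD (f x) (g x)))// lerD// dual_norm_ub.
Qed.

Fact dual_norm0_eq0 f : dual_norm f = 0 -> f = 0.
Proof.
move=> f0; apply/val_inj/funext => x /=.
have [->|x0] := eqVneq x 0; first exact: (linear0 f).
have n0 : `|x| != 0 by rewrite normr_eq0.
have := @dual_norm_ub f (`|x|^-1 *: x).
rewrite f0 normrZ normfV normr_id mulVf// lexx => /(_ isT).
rewrite normr_le0 linearZ/= scaler_eq0 invr_eq0 (negbTE n0)/=.
by move=> /eqP.
Qed.

Fact dual_normrZ (a : R[i]) f : dual_norm (a *: f) = `|a| * dual_norm f.
Proof.
have le b h : dual_norm (b *: h) <= `|b| * dual_norm h.
  apply: dual_norm_le => x x1.
  by rewrite (normrZ b (h x)) ler_wpM2l// dual_norm_ub.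
apply/eqP; rewrite eq_le le/=.
have [->|a0] := eqVneq a 0; first by rewrite normr0 mul0r dual_norm_ge0.
have := le a^-1 (a *: f).
rewrite scalerA mulVf// scale1r normfV => h.
by rewrite mulrC -ler_pdivlMr ?normr_gt0// mulrC.
Qed.

HB.instance Definition _ := @Lmodule_isNormed.Build R[i] dual_space
  dual_norm dual_ler_normD dual_normrZ dual_norm0_eq0.

End Dual.

Section Bases.
Variables (R : realType) (V : normedModType R[i]).
Implicit Types e : nat -> V.

Definition schauder_basis e :=
  forall x : V, exists! a : nat -> R[i],
    [series a i *: e i]_i @ \oo --> x.

Definition coordinate_functionals e (f : nat -> dual_space V) :=
  forall x : V, [series f i x *: e i]_i @ \oo --> x.

Definition normalized_seq e := forall i, `|e i| = 1.

(* the element of V that the coefficient sequence x in c00 represents *)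
Definition lincomb e (x : {fsfun nat -> R[i] with 0}) : V :=
  \sum_(i <- finsupp x) x i *: e i.

Definition unconditional1 e :=
  forall a b : {fsfun nat -> R[i] with 0},
    (forall i, `|a i| <= `|b i|) -> `|lincomb e a| <= `|lincomb e b|.

Definition strictly_unconditional1 e :=
  forall a b : {fsfun nat -> R[i] with 0},
    (forall i, `|a i| <= `|b i|) -> (exists i, `|a i| < `|b i|) ->
    `|lincomb e a| < `|lincomb e b|.

Definition span_is_l22 (u v : V) :=
  forall a b : R[i], `|a *: u + b *: v| ^+ 2 = `|a| ^+ 2 + `|b| ^+ 2.

End Bases.

Definition shrinking (R : realType) (V : normedModType R[i]) (e : nat -> V) :=
  exists2 f : nat -> dual_space V,
    coordinate_functionals e f & schauder_basis f.

Definition linear_isometry (R : realType) (V W : normedModType R[i])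
    (J : V -> W) :=
  [/\ linear J, forall x, `|J x| = `|x| & range J = setT].

Definition symmetric1 (R : realType) (V : normedModType R[i]) (e : nat -> V) :=
  forall p : nat -> nat, bijective p ->
    exists2 T : V -> V, linear_isometry T & forall i, T (e i) = e (p i).

Definition combinatorial (F : set {fset nat}) :=
  (forall i, F [fset i]%fset) /\
  (forall A B : {fset nat}, F A -> (B `<=` A)%fset -> F B).

Definition fset_indicator (A : {fset nat}) : cantor_space := fun i => i \in A.

Definition compact_family (F : set {fset nat}) := closed (fset_indicator @` F).

Definition norm_FE (R : realType) (E : normedModType R[i]) (F : set {fset nat})
    (b : nat -> E) (x : {fsfun nat -> R[i] with 0}) : R[i] :=
  (sup [set complex.Re `|\sum_(i <- A) x i *: b i| | A in F])%:C.

(* The Banach space X, with e the image of the canonical basis of c00, is a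
   completion of c00 for [norm_FE F b]: the linear map c00 -> X sending the
   canonical basis to e is norm-preserving and has dense range.  This
   determines (X, e) up to isometry. *)
Definition is_X_FE (R : realType) (E : normedModType R[i]) (F : set {fset nat})
    (b : nat -> E) (X : completeNormedModType R[i]) (e : nat -> X) :=
  (forall x, `|lincomb e x| = norm_FE F b x) /\ dense (range (lincomb e)).

(* [e1], [e2] are the canonical bases, or their coordinate functionals. *)
Definition compatible_signed_permutation (R : realType)
    (F1 F2 : set {fset nat}) (V W : normedModType R[i])
    (e1 : nat -> V) (e2 : nat -> W) (J : V -> W) :=
  exists (w : nat -> R[i]) (p : nat -> nat),
    [/\ forall i, `|w i| = 1,
        bijective p,
        [set [fset p i | i in A]%fset | A in F1] = F2 &
        forall i, J (e1 i) = w i *: e2 (p i)].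

(* Main.v *)
(* Both assertions follow from one abstract statement about a space with a
   1-unconditional system of vectors [e] and coordinates [c], no two of which
   span [l_2^2]; it applies to X and, with c_i(phi) = phi(e_i), to X^*.  For a
   surjective isometry J, the rank one projection Q = J P_i J^-1 = f (x) u,
   u = J e_i, is hermitian: 1 + (w - 1) Q is an isometry for |w| = 1.  If an
   off-diagonal entry f(e_k) c_j(u) were nonzero, conjugating Q by the sign
   change at j, subtracting and compressing to span(e_j, e_k) would generate a
   one-parameter flow along which the norm is constant, forcing
   span(e_j, e_k) = l_2^2.  Hence u is a multiple of a single e_k, unless f
   vanishes on all e_k; the latter is impossible by comparing 2 P_n u - u with
   its image 2 P_n u + u under 1 - 2 Q.

   For the families, if p(A) is not in F2 then the norm of its indicator is
   already attained on proper subsets, contradicting strict unconditionality;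
   in the dual case the norm of the indicator is recovered by averaging over
   cyclic shifts of A, using symmetry. *)

Require Import Defs.
From mathcomp Require Import all_boot all_order all_algebra.
From mathcomp Require Import finmap complex.
From mathcomp Require Import all_classical all_reals all_analysis.
From mathcomp Require Import ring lra.
Set Implicit Arguments.
Unset Strict Implicit.
Unset Printing Implicit Defensive.

Import Order.TTheory GRing.Theory Num.Theory.
Import numFieldTopology.Exports numFieldNormedType.Exports.
Local Open Scope classical_set_scope.
Local Open Scope ring_scope.
Local Open Scope complex_scope.

(** * Euclidean norms on the plane *)

(** Cutting [[0, K]] into [n] equal steps bounds the total increment by [C * K ^+ 2 / n], which is
    arbitrarily small. *)
Lemma const_of_quadratic_increments (R : realType) (f : R -> R) (C K : R) :
  0 <= K -> 0 <= C ->
  (forall u v, 0 <= u <= K -> 0 <= v <= K -> `|f v - f u| <= C * (v - u) ^+ 2) ->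
  f K = f 0.
Proof.
move=> K0 C0 H; apply/eqP; rewrite -subr_eq0 -normr_eq0; apply/eqP/le_anti.
rewrite normr_ge0 andbT leNgt; apply/negP => d0.
set d := `|f K - f 0| in d0.
have [n [n0 nd]] : exists n : nat, (0 < n)%N /\ C * K ^+ 2 < n%:R * d.
  exists (Num.Def.archi_bound (C * K ^+ 2 / d)).+1; split => //.
  rewrite -ltr_pdivrMr//; apply: lt_le_trans (archi_boundP _) _.
    by rewrite divr_ge0 ?mulr_ge0 ?sqr_ge0 // ltW.
  by rewrite ler_nat.
have n0' : 0 < n%:R :> R by rewrite ltr0n.
have st i : (i <= n)%N -> `|f (i%:R * (K / n%:R)) - f 0| <= i%:R * (C * (K / n%:R) ^+ 2).
  elim: i => [_|i IH ile]; first by rewrite !mul0r subrr normr0.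
  have inb j : (j <= n)%N -> 0 <= j%:R * (K / n%:R) <= K.
    move=> jn; rewrite mulr_ge0 ?divr_ge0 ?ler0n//=.
    by rewrite mulrA ler_pdivrMr// mulrC ler_wpM2l// ler_nat.
  have := H _ _ (inb i (ltnW ile)) (inb i.+1 ile).
  have := IH (ltnW ile).
  rewrite -mulrBl -natr1 (addrC i%:R) addrK mul1r => h1 h2.
  rewrite [leRHS]mulrDl mul1r.
  apply: le_trans (lerD h2 h1); apply: le_trans (ler_normD _ _).
  by rewrite addrA subrK.
have := st n (leqnn n).
rewrite mulrCA divff ?gt_eqF// mulr1 -/d => hd.
have : n%:R * d <= C * K ^+ 2.
  rewrite -ler_pdivlMl//; apply: le_trans hd _.
  rewrite le_eqVlt; apply/orP; left; apply/eqP.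
  by field; rewrite gt_eqF.
by rewrite leNgt nd.
Qed.

(** Multiplicative form: exchanging [u] and [v] and using [f <= B] turns the ratio bound into an
    increment bound with constant [C * B]. *)
Lemma const_of_quadratic_ratios (R : realType) (f : R -> R) (C K B : R) :
  0 <= K -> 0 <= C -> (forall u, 0 <= u <= K -> 0 <= f u <= B) ->
  (forall u v, 0 <= u <= K -> 0 <= v <= K -> f v <= (1 + C * (v - u) ^+ 2) * f u) ->
  f K = f 0.
Proof.
move=> K0 C0 fB H.
have B0 : 0 <= B.
  have /fB/andP[] : 0 <= (0 : R) <= K by rewrite lexx.
  exact: le_trans.
apply: (@const_of_quadratic_increments _ f (C * B) K) => //; first by rewrite mulr_ge0.
move=> u v uK vK.
have h1 := H u v uK vK; have h2 := H v u vK uK.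
have /andP[u1 u2] := fB u uK; have /andP[v1 v2] := fB v vK.
have D0 := sqr_ge0 (v - u); have E : (u - v) ^+ 2 = (v - u) ^+ 2 by ring.
rewrite E in h2; set D := (v - u) ^+ 2 in D0 h1 h2 *.
have CD : 0 <= C * D by rewrite mulr_ge0.
have k1 : C * D * f u <= C * D * B by rewrite ler_wpM2l.
have k2 : C * D * f v <= C * D * B by rewrite ler_wpM2l.
rewrite ler_norml; apply/andP; split; nra.
Qed.

(** To first order in [t], the map in the last hypothesis is a rotation preserving the form
    [r * a ^+ 2 + b ^+ 2]. Hence the square of [n] is this form, and comparison with the max norm
    and the sum norm forces [r = 1]. *)
Lemma plane_norm_euclidean (R : realType) (n : R -> R -> R) (C r : R) :
  0 <= C ->
  (forall t a b : R, 0 <= t -> n (t * a) (t * b) = t * n a b) ->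
  (forall a b : R, a <= n a b /\ b <= n a b) ->
  (forall a b : R, 0 <= a -> 0 <= b -> n a b <= a + b) ->
  (forall a b a' b' : R, 0 <= a <= a' -> 0 <= b <= b' -> n a b <= n a' b') ->
  (forall t a b : R, n (a + t * b) (b - t * r * a) <= (1 + C * t ^+ 2) * n a b) ->
  forall a b : R, 0 <= a -> 0 <= b -> n a b ^+ 2 = a ^+ 2 + b ^+ 2.
Proof.
move=> C0 nZ nge nle nmono nflow.
have n01 : n 0 1 = 1.
  by apply/le_anti; rewrite (nge 0 1).2 andbT; have := nle 0 1 (lexx _) ler01; rewrite add0r.
have nu u : 0 <= u -> 1 <= n u 1 <= u + 1.
  by move=> u0; rewrite (nge u 1).2 nle.
(* If [r <= 0], the flow from [(u, 1)] with [u, t >= 0] does not lower the second coordinate. By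
   monotonicity [n u 1] would then be constant on [[0, 2]], although [n 2 1 >= 2] and
   [n 0 1 = 1]. *)
have r0 : 0 < r.
  rewrite ltNge; apply/negP => r0.
  have : n 2 1 = n 0 1.
    apply: (@const_of_quadratic_ratios _ (n^~ 1) C 2 3) => //=.
    - by move=> u /andP[u0 u2]; have /andP[] := nu u u0; lra.
    - move=> u v /andP[u0 u2] /andP[v0 v2].
      have [uv|/ltW vu] := leP u v.
        apply: le_trans (nflow (v - u) u 1).
        rewrite mulr1 subrKC; apply: nmono; rewrite ?v0 ?lexx ?ler01//=.
        have : 0 <= (v - u) * - r * u by rewrite !mulr_ge0//; lra.
        by rewrite mulrN mulNr; lra.
      apply: (@le_trans _ _ (n u 1)).
        by apply: nmono; rewrite ?v0 ?vu ?ler01 ?lexx.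
      have /andP[? ?] := nu u u0.
      by rewrite ler_peMl ?lerDl ?(mulr_ge0 C0) ?sqr_ge0//; lra.
  by have := (nge 2 1).1; rewrite n01 => + E; rewrite E; lra.
(* The quotient of the squared norm by the invariant form; it is shown to be constant, and its value
   at 0 is 1. *)
pose G u := n u 1 ^+ 2 / (1 + r * u ^+ 2).
have D1 u : 1 <= 1 + r * u ^+ 2 by rewrite lerDl mulr_ge0 ?sqr_ge0// ltW.
have D0 u : 0 < 1 + r * u ^+ 2 by apply: lt_le_trans (D1 u).
have E u : 0 <= u -> n u 1 ^+ 2 = 1 + r * u ^+ 2.
  move=> u0.
  have : G u = G 0.
    (* With [d] the squared distance of two points of [[0, u]], [(1 + C * d) ^+ 2 <= 1 + (2 * C + C
       ^+ 2 * u ^+ 2) * d] because [d <= u ^+ 2]. *)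
    apply: (@const_of_quadratic_ratios _ G (2 * C + C ^+ 2 * u ^+ 2) u ((u + 1) ^+ 2)) => //.
    - by rewrite addr_ge0 ?mulr_ge0 ?sqr_ge0.
    - move=> v /andP[v0 vu]; rewrite divr_ge0 ?sqr_ge0 ?(ltW (D0 v))//=.
      have /andP[h1 h2] := nu v v0.
      rewrite /G ler_pdivrMr//; apply: (@le_trans _ _ ((u + 1) ^+ 2)); first nra.
      by rewrite ler_peMr ?sqr_ge0.
    - move=> v w /andP[v0 vu] /andP[w0 wu].
      have W : 0 < 1 + r * v * w by rewrite ltr_wpDr// !mulr_ge0// ltW.
      (* The time at which the flow carries [(v, 1)] onto the ray through [(w, 1)]. *)
      pose t := (w - v) / (1 + r * v * w).
      have Ea : v + t * 1 = (1 + r * v ^+ 2) / (1 + r * v * w) * w.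
        by rewrite /t; field; rewrite gt_eqF.
      have Eb : 1 - t * r * v = (1 + r * v ^+ 2) / (1 + r * v * w) * 1.
        by rewrite /t; field; rewrite gt_eqF.
      have := nflow t v 1; rewrite Ea Eb nZ; last by rewrite divr_ge0 ?ltW.
      have /andP[hv _] := nu v v0; have /andP[hw _] := nu w w0.
      have tw : t ^+ 2 <= (w - v) ^+ 2.
        rewrite /t expr_div_n ler_pdivrMr ?exprn_gt0// ler_peMr ?sqr_ge0//.
        by rewrite exprn_ege1// lerDl !mulr_ge0// ltW.
      rewrite mulrAC ler_pdivrMr// => h.
      have d0 := sqr_ge0 (w - v); have du : (w - v) ^+ 2 <= u ^+ 2 by nra.
      set d := (w - v) ^+ 2 in tw d0 du *.
      have h2 : (1 + r * v ^+ 2) * n w 1 <= (1 + C * d) * n v 1 * (1 + r * v * w).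
        apply: le_trans h _; apply: ler_wpM2r; first exact: ltW.
        by apply: ler_wpM2r; [lra|rewrite lerD2l ler_wpM2l].
      have h3 : (1 + r * v ^+ 2) ^+ 2 * n w 1 ^+ 2
             <= (1 + C * d) ^+ 2 * n v 1 ^+ 2 * (1 + r * v * w) ^+ 2.
        have nv0 : 0 <= n v 1 by lra.
        have nw0 : 0 <= n w 1 by lra.
        have Cd0 : 0 <= 1 + C * d by rewrite addr_ge0// mulr_ge0.
        by rewrite -!exprMn ler_sqr// nnegrE !mulr_ge0// ltW.
      (* Cauchy-Schwarz for the invariant form at [(v, 1)] and [(w, 1)]. *)
      have CS : (1 + r * v * w) ^+ 2 <= (1 + r * v ^+ 2) * (1 + r * w ^+ 2).
        rewrite -subr_ge0 [leRHS](_ : _ = r * (v - w) ^+ 2); last by ring.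
        by rewrite mulr_ge0 ?sqr_ge0 ?ltW.
      have h4 : (1 + r * v ^+ 2) * n w 1 ^+ 2
             <= (1 + C * d) ^+ 2 * n v 1 ^+ 2 * (1 + r * w ^+ 2).
        rewrite -(ler_pM2l (D0 v)) mulrA -expr2; apply: le_trans h3 _.
        rewrite [leRHS](_ : _ = (1 + C * d) ^+ 2 * n v 1 ^+ 2 *
          ((1 + r * v ^+ 2) * (1 + r * w ^+ 2))); last by ring.
        by rewrite ler_wpM2l// mulr_ge0 ?sqr_ge0.
      rewrite /G ler_pdivrMr// mulrA mulrAC ler_pdivlMr//.
      apply: (@le_trans _ _ ((1 + C * d) ^+ 2 * n v 1 ^+ 2 * (1 + r * w ^+ 2))).
        by rewrite mulrC.
      apply: ler_wpM2r; first exact: ltW.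
      apply: ler_wpM2r; first exact: sqr_ge0.
      have : C ^+ 2 * d * d <= C ^+ 2 * u ^+ 2 * d.
        by rewrite ler_wpM2r// ler_wpM2l ?sqr_ge0.
      by move=> ?; nra.
  rewrite /G n01 expr0n mulr0 addr0 expr1n divr1 => /(canRL (divfK _)).
  by rewrite mul1r; apply; rewrite gt_eqF.
have r1 : r = 1.
  apply/eqP; case: (ltgtP r 1) => // hr; exfalso.
    (* For [r < 1] this [u] satisfies [(1 - r) * u > 1] and [u > 1], which contradicts
       [u ^+ 2 <= n u 1 ^+ 2 = 1 + r * u ^+ 2]. *)
    pose u := (1 - r)^-1 + 1.
    have rr : 0 < 1 - r by lra.
    have V0 : 0 < (1 - r)^-1 by rewrite invr_gt0.
    have V1 : (1 - r) * (1 - r)^-1 = 1 by rewrite divff// gt_eqF.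
    have u0 : 0 <= u by rewrite /u; lra.
    have := (nge u 1).1; have := E u u0.
    have : (1 - r) * u = 1 + (1 - r) by rewrite /u mulrDr mulr1 V1.
    have : 1 < u by rewrite /u; lra.
    move=> h1 h2 h3 h4.
    have : u ^+ 2 <= n u 1 ^+ 2 by rewrite ler_sqr// nnegrE; lra.
    rewrite h3; nra.
  (* For [r > 1] this [u] satisfies [(r - 1) * u > 2], which contradicts
     [1 + r * u ^+ 2 <= (u + 1) ^+ 2]. *)
  pose u := 2 * (r - 1)^-1 + 1.
  have rr : 0 < r - 1 by lra.
  have V0 : 0 < (r - 1)^-1 by rewrite invr_gt0.
  have V1 : (r - 1) * (r - 1)^-1 = 1 by rewrite divff// gt_eqF.
  have u0 : 0 <= u by rewrite /u; lra.
  have /andP[h5 h6] := nu u u0; have := E u u0.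
  have : (r - 1) * u = 2 + (r - 1) by rewrite /u mulrDr mulr1 mulrCA V1 mulr1.
  have : 1 < u by rewrite /u; lra.
  move=> h1 h2 h3.
  have : n u 1 ^+ 2 <= (u + 1) ^+ 2 by rewrite ler_sqr// nnegrE; lra.
  rewrite h3; nra.
move=> a b a0; rewrite le_eqVlt => /predU1P[<-|b0].
  rewrite expr0n addr0; congr (_ ^+ 2); apply/le_anti.
  by rewrite (nge a 0).1 andbT; have := nle a 0 a0 (lexx _); rewrite addr0.
have -> : n a b = b * n (a / b) 1.
  by rewrite -nZ ?ltW// mulr1 mulrCA divff ?gt_eqF// mulr1.
rewrite exprMn E ?divr_ge0 ?(ltW b0)// r1; field; rewrite gt_eqF//.
Qed.

(** * Hermitian operators *)

Section RealValuedNorm.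
Variable R : realType.
Implicit Types (V : normedModType R[i]) (a b w : R[i]).

(** [cmod] and [nr] move moduli and norms from [R[i]], which is only partially ordered, into the
    ordered field [R]. *)
Definition cmod a : R := complex.Re `|a|.

Definition nr V (x : V) : R := complex.Re `|x|.

Lemma cmodE a : (cmod a)%:C = `|a|.
Proof. by apply: RRe_real; apply: normr_real. Qed.

Lemma nrE V (x : V) : (nr x)%:C = `|x|.
Proof. exact: Re_normK. Qed.

Lemma nr_le V (W : normedModType R[i]) (x : V) (y : W) : (`|x| <= `|y|) = (nr x <= nr y).
Proof. by rewrite -!nrE lecR. Qed.

Lemma nr_ge0 V (x : V) : 0 <= nr x.
Proof. by rewrite -lecR nrE normr_ge0. Qed.

Lemma nrZ V a (x : V) : nr (a *: x) = cmod a * nr x.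
Proof. by apply: (@complexI R); rewrite rmorphM/= cmodE !nrE normrZ. Qed.

Lemma nrD V (x y : V) : nr (x + y) <= nr x + nr y.
Proof. by rewrite -lecR rmorphD/= !nrE ler_normD. Qed.

Lemma nrN V (x : V) : nr (- x) = nr x.
Proof. by rewrite /nr normrN. Qed.

Lemma nrB V (x y : V) : nr (x - y) <= nr x + nr y.
Proof. by rewrite -[in leRHS](nrN y) nrD. Qed.

Lemma nr_dist V (x y : V) : nr (x - y) = nr (y - x).
Proof. by rewrite -nrN opprB. Qed.

Lemma nr0 V : nr (0 : V) = 0.
Proof. by rewrite /nr normr0. Qed.

Lemma nr0_eq0 V (x : V) : nr x = 0 -> x = 0.
Proof. by move=> h; apply/eqP; rewrite -normr_eq0 -nrE h. Qed.

Lemma nr_sum V (I : Type) (s : seq I) (P : pred I) (F : I -> V) :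
  nr (\sum_(i <- s | P i) F i) <= \sum_(i <- s | P i) nr (F i).
Proof.
elim/big_rec2 : _ => [|i y x _ h]; first by rewrite nr0.
by apply: le_trans (nrD _ _) _; rewrite lerD2l.
Qed.

Lemma cmod_ge0 a : 0 <= cmod a.
Proof. by rewrite -lecR cmodE normr_ge0. Qed.

Lemma cmodM a b : cmod (a * b) = cmod a * cmod b.
Proof. by apply: (@complexI R); rewrite rmorphM/= !cmodE normrM. Qed.

Lemma cmodV a : cmod a^-1 = (cmod a)^-1.
Proof. by apply: (@complexI R); rewrite fmorphV/= !cmodE normfV. Qed.

Lemma cmodD a b : cmod (a + b) <= cmod a + cmod b.
Proof. by rewrite -lecR rmorphD/= !cmodE ler_normD. Qed.

Lemma cmodN a : cmod (- a) = cmod a.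
Proof. by rewrite /cmod normrN. Qed.

Lemma cmodB a b : cmod (a - b) = cmod (b - a).
Proof. by rewrite -cmodN opprB. Qed.

Lemma cmodR (t : R) : cmod t%:C = `|t|.
Proof. by rewrite /cmod normc_def/= expr0n addr0 sqrtr_sqr. Qed.

Lemma cmod1 : cmod 1 = 1.
Proof. by rewrite /cmod normr1. Qed.

Lemma cmod0 : cmod 0 = 0.
Proof. by rewrite /cmod normr0. Qed.

Lemma cmod_eq0 a : (cmod a == 0) = (a == 0).
Proof. by rewrite -(inj_eq (@complexI R)) cmodE normr_eq0. Qed.

Lemma cmod_i : cmod 'i = 1.
Proof. by rewrite /cmod normc_def/= expr0n add0r expr1n sqrtr1. Qed.

Lemma cmod_sqr a : cmod a ^+ 2 = complex.Re a ^+ 2 + complex.Im a ^+ 2.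
Proof. by rewrite /cmod normc_def sqr_sqrtr// addr_ge0 ?sqr_ge0. Qed.

Lemma cmodJ a : cmod a^*%C = cmod a.
Proof. by rewrite /cmod normcJ. Qed.

Lemma Re_le_cmod a : `|complex.Re a| <= cmod a.
Proof. by rewrite -lecR cmodE normc_ge_Re. Qed.

Lemma cmod_eq1 a : `|a| = 1 <-> cmod a = 1.
Proof.
by split=> [h|h]; [rewrite /cmod h|rewrite -cmodE h].
Qed.

(* [w = (1 + i t) / (1 - i t)] runs through the unit circle and
   [w - 1 = 2 i t + O(t^2)]; the product of the contractions
   [1 + (w - 1) A] and [1 + (w^-1 - 1) B] is [1 + 2 i t (A - B) + O(t^2)]. *)
Lemma infinitesimal_rotation_diff V (A B : V -> V) :
  linear A ->
  (forall w x, cmod w = 1 -> nr (x + (w - 1) *: A x) <= nr x) ->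
  (forall w x, cmod w = 1 -> nr (x + (w - 1) *: B x) <= nr x) ->
  forall (t : R) x, nr (x + (2 * 'i * t%:C) *: (A x - B x)) <= (1 + 8 * t ^+ 2) * nr x.
Proof.
move=> linA hA hB t x.
(* At [w = -1] the hypothesis says that [1 - 2 T] is a contraction; [T] is half the difference of
   the identity and this map. *)
have contr T : (forall w x, cmod w = 1 -> nr (x + (w - 1) *: T x) <= nr x) ->
    forall y : V, nr (T y) <= nr y.
  move=> hT y; have := hT (-1) y; rewrite cmodN cmod1 => /(_ erefl) h.
  have -> : T y = (2^-1 : R[i]) *: (y - (y + (-1 - 1) *: T y)).
    rewrite opprD addNKr -scaleNr scalerA.
    by rewrite [X in X *: _](_ : _ = 1) ?scale1r//; field.
  rewrite nrZ [cmod _](_ : _ = 2^-1).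
    by have := nrB y (y + (-1 - 1) *: T y); lra.
  rewrite cmodV; congr (_^-1).
  by rewrite -(rmorph_nat (@real_complex R) 2) cmodR ger0_norm.
have i2 : ('i : R[i]) * 'i = -1 by rewrite -expr2 sqr_i.
pose z : R[i] := 1 - 'i * t%:C.
have z2 : cmod z ^+ 2 = 1 + t ^+ 2.
  by rewrite cmod_sqr /z; simpc; rewrite /= ; ring.
have z1 : 1 <= cmod z.
  by rewrite -(@ler_pXn2r _ 2) ?nnegrE ?cmod_ge0// z2 expr1n lerDl sqr_ge0.
have z0 : z != 0 by rewrite -cmod_eq0 gt_eqF// (lt_le_trans ltr01).
have zJ0 : z^*%C != 0 by rewrite conjc_eq0.
have zJ : z^*%C = 1 + 'i * t%:C by rewrite /z; simpc.
pose w := z^*%C / z.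
have w1 : cmod w = 1 by rewrite cmodM cmodV cmodJ divff// cmod_eq0.
have v1 : cmod w^-1 = 1 by rewrite cmodV w1 invr1.
pose y := x + (w^-1 - 1) *: B x.
have hy : nr (y + (w - 1) *: A y) <= nr x by apply: le_trans (hA _ _ w1) (hB _ _ v1).
have Ay : A y = A x + (w^-1 - 1) *: A (B x).
  by rewrite /y addrC linA addrC.
have ew : w - 1 = 2 * 'i * t%:C / z.
  by rewrite /w zJ /z; field.
have ev : w^-1 - 1 = - (2 * 'i * t%:C) / z^*%C.
  by rewrite /w zJ /z; field; rewrite -zJ zJ0.
have tt (c : R[i]) : 2 * 'i * t%:C * ('i * t%:C) * c = - (2 * t%:C ^+ 2) * c.
  rewrite [LHS](_ : _ = ('i * 'i) * (2 * t%:C ^+ 2 * c)); last by ring.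
  by rewrite i2; ring.
(* The exact second order errors in the coefficients of [A x], [B x] and [A (B x)]. Since
   [cmod z >= 1], they contribute at most 2, 2 and 4 times [t ^+ 2 * nr x], whence the constant
   8. *)
have c1 : 2 * 'i * t%:C - (w - 1) = (2 * t ^+ 2)%:C / z.
  rewrite ew [LHS](_ : _ = - (2 * 'i * t%:C * ('i * t%:C) * z^-1)).
    by rewrite tt rmorphM/= rmorph_nat rmorphXn/= mulNr opprK.
  by rewrite /z; field.
have c2 : - (2 * 'i * t%:C) - (w^-1 - 1) = (2 * t ^+ 2)%:C / z^*%C.
  rewrite ev [LHS](_ : _ = - (2 * 'i * t%:C * ('i * t%:C) * (z^*%C)^-1)).
    by rewrite tt rmorphM/= rmorph_nat rmorphXn/= mulNr opprK.
  by rewrite zJ; field; rewrite -zJ.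
have c3 : (w - 1) * (w^-1 - 1) = (4 * t ^+ 2)%:C / z / z^*%C.
  rewrite ew ev [LHS](_ : _ = - (2 * 'i * t%:C * ('i * t%:C) * (2 * (z^-1 / z^*%C)))).
    rewrite tt rmorphM/= rmorph_nat rmorphXn/= mulNr opprK.
    by field; rewrite z0 zJ0.
  by field; rewrite z0 zJ0.
have zV : cmod z^-1 <= 1 by rewrite cmodV invf_le1 // (lt_le_trans ltr01).
have zJV : cmod (z^*%C)^-1 <= 1 by rewrite cmodV cmodJ invf_le1 // (lt_le_trans ltr01).
have -> : x + (2 * 'i * t%:C) *: (A x - B x) = (y + (w - 1) *: A y)
    + ((2 * t ^+ 2)%:C / z) *: A x + ((2 * t ^+ 2)%:C / z^*%C) *: B x
    - ((4 * t ^+ 2)%:C / z / z^*%C) *: A (B x).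
  rewrite -c1 -c2 -c3 Ay /y scalerBr scalerDr scalerA.
  have zid (u q p s k l : V) :
      u + q + (p + s) + (k - p) + (- l - q) - s = u + (k - l).
    by rewrite !addrA (ACl ((1 * 5 * 7) * (2 * 8) * (3 * 6) * (4 * 9)))/= !subrr !addr0.
  by rewrite (scalerBl (2 * 'i * t%:C)) (scalerBl (- (2 * 'i * t%:C))) scaleNr zid.
have t2 : 0 <= t ^+ 2 by rewrite sqr_ge0.
have b1 := contr A hA x; have b2 := contr B hB x.
have b3 := le_trans (contr A hA (B x)) b2.
have n0 := nr_ge0 x.
have aux (u : V) (c : R) (d : R[i]) : 0 <= c -> cmod d <= 1 -> nr u <= nr x ->
    nr ((c%:C * d) *: u) <= c * nr x.
  move=> c0 d1 ux; rewrite nrZ cmodM cmodR ger0_norm// -mulrA ler_wpM2l//.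
  by rewrite (le_trans _ ux)// ler_piMl// nr_ge0.
apply: le_trans (nrB _ _) _; apply: le_trans (lerD (nrD _ _) (lexx _)) _.
apply: le_trans (lerD (lerD (nrD _ _) (lexx _)) (lexx _)) _.
have e1' : nr (((2 * t ^+ 2)%:C / z) *: A x) <= 2 * t ^+ 2 * nr x by apply: aux => //; lra.
have e2' : nr (((2 * t ^+ 2)%:C / z^*%C) *: B x) <= 2 * t ^+ 2 * nr x by apply: aux => //; lra.
have e3' : nr (((4 * t ^+ 2)%:C / z / z^*%C) *: A (B x)) <= 4 * t ^+ 2 * nr x.
  by rewrite -mulrA; apply: aux => //; [lra|rewrite cmodM mulr_ile1 ?cmod_ge0].
lra.
Qed.

End RealValuedNorm.

(** * Planes whose norm depends only on the moduli of the coefficients *)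

Section RotationInvariantPair.
Variables (R : realType) (V : normedModType R[i]) (u v : V).
Hypotheses (nu : nr u = 1) (nv : nr v = 1).
Hypothesis rotl : forall w a b : R[i], cmod w = 1 ->
  nr ((w * a) *: u + b *: v) <= nr (a *: u + b *: v).
Hypothesis rotr : forall w a b : R[i], cmod w = 1 ->
  nr (a *: u + (w * b) *: v) <= nr (a *: u + b *: v).

Lemma polar_decomposition (a : R[i]) :
  exists2 w : R[i], cmod w = 1 & a = w * (cmod a)%:C.
Proof.
have [->|a0] := eqVneq a 0; first by exists 1; rewrite ?cmod1// cmod0 mulr0.
have ca0 : cmod a != 0 by rewrite cmod_eq0.
have ca : (cmod a)%:C != 0 :> R[i] by rewrite -(rmorph0 (@real_complex R)) (inj_eq (@complexI R)).
exists (a / (cmod a)%:C); last by rewrite divfK.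
by rewrite cmodM cmodV cmodR ger0_norm ?cmod_ge0// divff.
Qed.

(** Rotations by a sign and by its inverse both decrease the norm, so they preserve it; polar
    decomposition then reduces any coefficients to their moduli. *)
Lemma nr_pair_mod (a b a' b' : R[i]) : cmod a = cmod a' -> cmod b = cmod b' ->
  nr (a *: u + b *: v) = nr (a' *: u + b' *: v).
Proof.
have le c d c' d' : cmod c = cmod c' -> cmod d = cmod d' ->
    nr (c *: u + d *: v) <= nr (c' *: u + d' *: v).
  move=> ec ed.
  have [w w1 ->] := polar_decomposition c; have [z z1 ->] := polar_decomposition d.
  have [w' w'1 Ec] := polar_decomposition c'; have [z' z'1 Ed] := polar_decomposition d'.
  have w'0 : w' != 0 by rewrite -cmod_eq0 w'1 oner_eq0.
  have z'0 : z' != 0 by rewrite -cmod_eq0 z'1 oner_eq0.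
  apply: le_trans (rotl _ _ w1) _; apply: le_trans (rotr _ _ z1) _.
  rewrite ec ed.
  have -> : (cmod c')%:C = w'^-1 * c' by rewrite {2}Ec mulKf.
  have -> : (cmod d')%:C = z'^-1 * d' by rewrite {2}Ed mulKf.
  apply: le_trans (rotl _ _ _) _; first by rewrite cmodV w'1 invr1.
  by apply: rotr; rewrite cmodV z'1 invr1.
by move=> ea eb; apply/le_anti; rewrite !le.
Qed.

Let n (a b : R) : R := nr (a%:C *: u + b%:C *: v).

Lemma nr_pairE a b : nr (a *: u + b *: v) = n (cmod a) (cmod b).
Proof. by apply: nr_pair_mod; rewrite cmodR ger0_norm ?cmod_ge0. Qed.

(** The vector of real parts is the average of the given vector and the one with conjugate
    coefficients, which has the same norm. *)
Lemma nr_pair_Re a b : n (complex.Re a) (complex.Re b) <= nr (a *: u + b *: v).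
Proof.
have avg c d c' d' : nr (c *: u + d *: v) = nr (c' *: u + d' *: v) ->
    nr ((c + c') *: u + (d + d') *: v) <= 2 * nr (c *: u + d *: v).
  move=> e; have := nrD (c *: u + d *: v) (c' *: u + d' *: v).
  by rewrite -e addrACA -!scalerDl -mulr2n mulr_natl.
have := avg a b a^*%C b^*%C (nr_pair_mod (esym (cmodJ _)) (esym (cmodJ _))).
rewrite !addcJ -!scalerA -scalerDr nrZ -(rmorph_nat (@real_complex R) 2) cmodR.
by rewrite ger0_norm// ler_pM2l.
Qed.

(** Each number of [[0, y]] is the real part of a complex number of modulus [y], namely its [lift];
    so monotonicity follows from [nr_pair_Re]. *)
Lemma n_mono a b a' b' : 0 <= a <= a' -> 0 <= b <= b' -> n a b <= n a' b'.
Proof.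
move=> /andP[a0 aa] /andP[b0 bb].
pose lift (x y : R) : R[i] := x +i* Num.sqrt (y ^+ 2 - x ^+ 2).
have cl x y : 0 <= x -> x <= y -> cmod (lift x y) = y.
  move=> x0 xy; have y0 := le_trans x0 xy.
  rewrite /cmod normc_def/= sqr_sqrtr ?subrKC ?sqrtr_sqr ?ger0_norm//.
  by rewrite subr_ge0 ler_sqr.
have := nr_pair_Re (lift a a') (lift b b').
by rewrite nr_pairE !cl.
Qed.

Lemma span_is_l22_nr :
  (forall a b : R, 0 <= a -> 0 <= b -> n a b ^+ 2 = a ^+ 2 + b ^+ 2) <->
  span_is_l22 u v.
Proof.
split=> [H a b|H a b a0 b0].
  by rewrite -nrE nr_pairE -!cmodE -!rmorphXn/= H ?cmod_ge0// rmorphD.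
have := H a%:C b%:C; rewrite -nrE -!cmodE -!rmorphXn -rmorphD /= => /(@complexI R).
by rewrite !cmodR !ger0_norm.
Qed.

(** A unimodular change of the second coefficient and a rescaling of time make the real parts of
    this flow follow the real flow of [plane_norm_euclidean]; taking real parts does not increase
    the norm. *)
Lemma span_is_l22_of_flow (q q' : R[i]) (C : R) : q != 0 -> 0 <= C ->
  (forall (t : R) a b, nr ((a + 'i * t%:C * b * q) *: u + (b + 'i * t%:C * a * q') *: v)
     <= (1 + C * t ^+ 2) * nr (a *: u + b *: v)) ->
  span_is_l22 u v.
Proof.
move=> q0 C0 H; apply/span_is_l22_nr.
have i0 : 'i != 0 :> R[i] by rewrite -cmod_eq0 cmod_i oner_eq0.
have Q0 : 0 < cmod q by rewrite lt_neqAle cmod_ge0 eq_sym cmod_eq0 q0.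
have Qc : (cmod q)%:C != 0 :> R[i] by rewrite -cmod_eq0 cmodR normr_eq0 gt_eqF.
(* Replacing [b] by [m * b] and [t] by [t / cmod q] makes the first coefficient [a + t * b].
   Factoring [m] out of the second one leaves the coupling [s], whose real part yields [r]. *)
pose m : R[i] := (cmod q)%:C / ('i * q).
have m1 : cmod m = 1.
  by rewrite /m cmodM cmodV cmodM cmod_i mul1r cmodR ger0_norm ?cmod_ge0// divff ?gt_eqF.
have m0 : m != 0 by rewrite -cmod_eq0 m1 oner_eq0.
pose s := 'i * q' / m.
apply: (@plane_norm_euclidean _ n (C / cmod q ^+ 2) (- complex.Re s / cmod q)).
- by rewrite divr_ge0 ?exprn_ge0 ?cmod_ge0.
- move=> t a b t0; rewrite /n !rmorphM/= -!scalerA -scalerDr nrZ cmodR ger0_norm//.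
(* Changing the sign of one coefficient keeps the norm, and the two vectors add up to twice a
   multiple of [u] or of [v]. *)
- move=> a b.
  split; apply: le_trans (ler_norm _) _.
    have := nrD (a%:C *: u + b%:C *: v) (a%:C *: u + (- b%:C) *: v).
    rewrite [nr (_ + (- _) *: _)](@nr_pair_mod _ _ a%:C b%:C) ?cmodN//.
    rewrite scaleNr addrACA subrr addr0 -mulr2n -scaler_nat nrZ nrZ nu mulr1.
    rewrite -(rmorph_nat (@real_complex R) 2) !cmodR ger0_norm// -/(n a b); lra.
  have := nrD (a%:C *: u + b%:C *: v) ((- a%:C) *: u + b%:C *: v).
  rewrite [nr ((- _) *: _ + _)](@nr_pair_mod _ _ a%:C b%:C) ?cmodN//.
  rewrite scaleNr addrACA subrr add0r -mulr2n -scaler_nat nrZ nrZ nv mulr1.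
  by rewrite -(rmorph_nat (@real_complex R) 2) !cmodR ger0_norm// -/(n a b); lra.
- move=> a b a0 b0; apply: le_trans (nrD _ _) _.
  by rewrite !nrZ nu nv !mulr1 !cmodR !ger0_norm.
- exact: n_mono.
move=> t a b.
pose t' := t / cmod q.
have := H t' a%:C (m * b%:C).
rewrite [nr _ in leRHS](@nr_pair_mod _ _ a%:C b%:C)//; last by rewrite cmodM m1 mul1r.
rewrite [nr _ in leLHS](@nr_pair_mod _ _ (a%:C + t%:C * b%:C) (b%:C + t'%:C * a%:C * s)).
- have R1 : complex.Re (a%:C + t%:C * b%:C) = a + t * b by simpc.
  have R2 : complex.Re (b%:C + t'%:C * a%:C * s) = b - t * (- complex.Re s / cmod q) * a.
    by rewrite /t'; case: (s) => x y; simpc; rewrite /=; ring.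
  move=> h; rewrite -R1 -R2; apply: le_trans (nr_pair_Re _ _) (le_trans h _).
  by rewrite /n /t' expr_div_n mulrA mulrAC.
- congr cmod; congr (_ + _); rewrite /m /t' rmorphM/= fmorphV/=; field.
  by rewrite i0 q0 Qc.
- rewrite -[RHS]mul1r -m1 -cmodM; congr cmod; rewrite /s; field.
  by rewrite m0.
Qed.

End RotationInvariantPair.

(** * Isometries between spaces with coordinates *)

(** An interface shared by a space and its dual. [coord_rotation] says that the coordinate
    projections are hermitian. [coord_total] follows from norm convergence of the partial sums,
    which would give [3 * nr x <= nr x], but also, for functionals, from pointwise convergence. *)
Record coord_system (R : realType) (V : normedModType R[i])
    (e : nat -> V) (c : nat -> V -> R[i]) : Prop := CoordSystem {
  coord_linear : forall i a x y, c i (a *: x + y) = a * c i x + c i y;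
  coord_basis : forall i j, c i (e j) = (i == j)%:R;
  coord_norm1 : forall i, nr (e i) = 1;
  coord_pair : forall j k x, j != k -> nr (c j x *: e j + c k x *: e k) <= nr x;
  coord_rotation : forall w i x, cmod w = 1 -> nr (x + ((w - 1) * c i x) *: e i) <= nr x;
  coord_total : forall x,
    (forall n, nr (x + 2 *: \sum_(i < n) c i x *: e i) <= nr x) -> x = 0 }.

Section CoordSystem.
Variables (R : realType) (V : normedModType R[i]).
Variables (e : nat -> V) (c : nat -> V -> R[i]).
Hypothesis ec : coord_system e c.

Lemma coordD i x y : c i (x + y) = c i x + c i y.
Proof. by rewrite -[x]scale1r (coord_linear ec) mul1r scale1r. Qed.

Lemma coord0 i : c i 0 = 0.
Proof. by apply: (addrI (c i 0)); rewrite -coordD !addr0. Qed.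

Lemma coordZ i a x : c i (a *: x) = a * c i x.
Proof. by rewrite -[a *: x]addr0 (coord_linear ec) coord0 addr0. Qed.

Lemma coordN i x : c i (- x) = - c i x.
Proof. by rewrite -scaleN1r coordZ mulN1r. Qed.

Lemma coord_ee i : c i (e i) = 1.
Proof. by rewrite (coord_basis ec) eqxx. Qed.

Lemma coord_ne i j : i != j -> c i (e j) = 0.
Proof. by rewrite (coord_basis ec) => /negbTE ->. Qed.

Lemma coord_partial_sum (a : nat -> R[i]) k n :
  c k (\sum_(i < n) a i *: e i) = if (k < n)%N then a k else 0.
Proof.
elim: n => [|n IH]; first by rewrite big_ord0 coord0.
rewrite big_ord_recr/= coordD IH coordZ (coord_basis ec) ltnS.
by case: (ltngtP k n) => [kn|kn|->]; rewrite ?mulr0 ?addr0 ?mulr1 ?add0r.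
Qed.

Lemma coord_sum (I : Type) (s : seq I) (a : I -> R[i]) (f : I -> V) k :
  c k (\sum_(i <- s) a i *: f i) = \sum_(i <- s) a i * c k (f i).
Proof.
elim: s => [|i s IH]; first by rewrite !big_nil coord0.
by rewrite !big_cons coordD coordZ IH.
Qed.

Lemma coord_separates x : (forall i, c i x = 0) -> x = 0.
Proof.
move=> x0; apply: (coord_total ec) => n.
by rewrite big1 ?scaler0 ?addr0// => i _; rewrite x0 scale0r.
Qed.

(** The signs of the first [n] coordinates are changed one at a time, each change being a rotation
    with [w = -1]. *)
Lemma coord_flip x n : nr (x - 2 *: \sum_(i < n) c i x *: e i) <= nr x.
Proof.
elim: n => [|n IH]; first by rewrite big_ord0 scaler0 subr0.
apply: le_trans IH; set y := (X in _ <= nr X).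
have cy : c n y = c n x by rewrite coordD coordN coordZ (coord_partial_sum (c^~ x)) ltnn mulr0 subr0.
have := coord_rotation ec n y (w := -1); rewrite cmodN cmod1 cy => /(_ erefl).
rewrite -opprD -mulr2n mulNr scaleNr.
congr (nr _ <= _); rewrite /y big_ord_recr/= scalerDr opprD addrA; congr (_ + _).
by rewrite scalerA.
Qed.

Lemma coord_rotl j k : j != k -> forall w a b : R[i], cmod w = 1 ->
  nr ((w * a) *: e j + b *: e k) <= nr (a *: e j + b *: e k).
Proof.
move=> jk w a b w1; have := coord_rotation ec j (a *: e j + b *: e k) w1.
rewrite coordD !coordZ coord_ee coord_ne// mulr0 addr0 mulr1.
by rewrite addrAC -scalerDl -{1}[a]mul1r -mulrDl subrKC.
Qed.

Lemma coord_rotr j k : j != k -> forall w a b : R[i], cmod w = 1 ->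
  nr (a *: e j + (w * b) *: e k) <= nr (a *: e j + b *: e k).
Proof.
move=> jk w a b w1.
by rewrite !(addrC (a *: e j)); apply: coord_rotl; rewrite // eq_sym.
Qed.

(** With [D] the sign change at [j], [B = D Q D] is hermitian too. In the plane of [e j] and [e k],
    the difference of [Q] and [B] has zero diagonal and twice the off-diagonal entries of [Q]. *)
Lemma span_is_l22_of_hermitian (Q : V -> V) j k : j != k -> linear Q ->
  (forall w x, cmod w = 1 -> nr (x + (w - 1) *: Q x) <= nr x) ->
  c j (Q (e k)) != 0 -> span_is_l22 (e j) (e k).
Proof.
move=> jk linQ hQ q0.
have kj : k != j by rewrite eq_sym.
pose D x := x - (2 * c j x) *: e j.
have Dn x : nr (D x) <= nr x.
  have := coord_rotation ec j x (w := -1); rewrite cmodN cmod1 => /(_ erefl).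
  by rewrite /D -opprD -mulr2n mulNr scaleNr.
have DD x : D (D x) = x.
  rewrite /D coordD coordN coordZ coord_ee mulr1 -addrA -opprD -scalerDl.
  rewrite [X in X *: _](_ : _ = 0) ?scale0r ?subr0//; ring.
have Dlin a x y : D (x + a *: y) = D x + a *: D y.
  rewrite /D coordD coordZ scalerBr scalerA mulrDr scalerDl opprD addrACA.
  by congr (_ + (_ - _ *: _)); ring.
pose B x := D (Q (D x)).
have hB w x : cmod w = 1 -> nr (x + (w - 1) *: B x) <= nr x.
  move=> w1; rewrite -{1}(DD x) /B -Dlin.
  by apply: le_trans (Dn _) _; apply: le_trans (hQ _ _ w1) (Dn _).
have QD x y : Q (x + y) = Q x + Q y by rewrite -[x]scale1r linQ !scale1r.
have Q0 : Q 0 = 0 by apply: (addrI (Q 0)); rewrite -QD !addr0.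
have QZ a x : Q (a *: x) = a *: Q x by rewrite -[a *: x]addr0 linQ Q0 addr0.
(* The 4 is the 2 of the generator [2 * 'i * t] times the doubling of the off-diagonal entries; the
   8 comes from [infinitesimal_rotation_diff]. *)
apply: (@span_is_l22_of_flow _ _ (e j) (e k) (coord_norm1 ec j) (coord_norm1 ec k)
  (coord_rotl jk) (coord_rotr jk) (4 * c j (Q (e k))) (4 * c k (Q (e j))) 8).
- by rewrite mulf_neq0// pnatr_eq0.
- by [].
move=> t a b; set x := a *: e j + b *: e k.
have cx : (c j x = a) * (c k x = b).
  by rewrite /x !coordD !coordZ !coord_ee !coord_ne// !mulr0 !mulr1 addr0 add0r.
have cD y : (c j (D y) = - c j y) * (c k (D y) = c k y).
  by rewrite /D !coordD !coordN !coordZ !coord_ee !coord_ne// mulr0 subr0; split => //; ring.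
have Dx : D x = (- a) *: e j + b *: e k.
  by rewrite /D cx /x addrAC -scalerBl; congr (_ *: _ + _); ring.
have := infinitesimal_rotation_diff linQ hQ hB t x.
move=> /(le_trans (coord_pair ec _ jk)); congr (nr (_ *: _ + _ *: _) <= _);
  rewrite coordD coordZ coordD coordN /B cD Dx cx /x !QD !QZ !coordD !coordZ; ring.
Qed.

End CoordSystem.

(** * Images of basis vectors under isometries *)

Section Isometries.
Variable R : realType.
Implicit Types V W : normedModType R[i].

Lemma linear_isometry_inverse V W (J : V -> W) : linear_isometry J ->
  exists K : W -> V, [/\ linear_isometry K, cancel J K & cancel K J].
Proof.
move=> [Jlin Jnorm Jsurj].
have /choice[K KJ] : forall y, exists x, J x = y.
  move=> y; have [x _ <-] : range J y by rewrite Jsurj.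
  by exists x.
have JB x y : J (x - y) = J x - J y.
  by rewrite addrC -scaleN1r Jlin scaleN1r addrC.
have Jinj : injective J.
  by move=> x y xy; apply/eqP; rewrite -subr_eq0 -normr_eq0 -Jnorm JB xy subrr normr0.
have JK : cancel J K by move=> x; apply: Jinj; rewrite KJ.
exists K; split => //; split.
- by move=> a x y; apply: Jinj; rewrite Jlin !KJ.
- by move=> y; rewrite -Jnorm KJ.
- by apply/seteqP; split => // x _; exists (J x).
Qed.

Variables (V W : normedModType R[i]).
Variables (e1 : nat -> V) (c1 : nat -> V -> R[i]) (e2 : nat -> W) (c2 : nat -> W -> R[i]).
Hypotheses (ec1 : coord_system e1 c1) (ec2 : coord_system e2 c2).

(* [Q] is the rank one hermitian projection [J P_i J^-1]; its off-diagonal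
   entries vanish.  If the functional of [Q] killed all of [span(e2)], then
   [1 - 2 Q] would map [2 P_n u - u] to [2 P_n u + u] for all [n]. *)
Lemma isometry_basis_vector (J : V -> W) (i : nat) :
  (forall j k, j <> k -> ~ span_is_l22 (e2 j) (e2 k)) -> linear_isometry J ->
  exists w k, cmod w = 1 /\ J (e1 i) = w *: e2 k.
Proof.
move=> nl22 iJ; have [K [iK JK KJ]] := linear_isometry_inverse iJ.
have [Jlin Jnorm _] := iJ; have [Klin Knorm _] := iK.
have nJ x : nr (J x) = nr x by rewrite /nr Jnorm.
have nK x : nr (K x) = nr x by rewrite /nr Knorm.
set u := J (e1 i).
have nu : nr u = 1 by rewrite nJ (coord_norm1 ec1).
have KD x y : K (x + y) = K x + K y by rewrite -[x]scale1r Klin !scale1r.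
have K0 : K 0 = 0 by apply: (addrI (K 0)); rewrite -KD !addr0.
have KZ a x : K (a *: x) = a *: K x by rewrite -[a *: x]addr0 Klin K0 addr0.
pose f y := c1 i (K y).
have fD x y : f (x + y) = f x + f y by rewrite /f KD (coordD ec1).
have fZ a x : f (a *: x) = a * f x by rewrite /f KZ (coordZ ec1).
pose Q y := f y *: u.
have linQ : linear Q by move=> a x y; rewrite /Q fD fZ scalerDl scalerA.
have hQ w y : cmod w = 1 -> nr (y + (w - 1) *: Q y) <= nr y.
  move=> w1; have -> : y + (w - 1) *: Q y = J (K y + ((w - 1) * f y) *: e1 i).
    by rewrite [in RHS]addrC Jlin KJ scalerA addrC.
  by rewrite nJ -(nK y); apply: coord_rotation.
have offdiag j k : j != k -> f (e2 k) * c2 j u = 0.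
  move=> jk; apply/eqP/negPn/negP => h; apply: (nl22 j k); first exact/eqP.
  by apply: (span_is_l22_of_hermitian ec2 jk linQ hQ); rewrite /Q (coordZ ec2).
(* If [f (e2 k)] is nonzero, [offdiag] kills every coordinate of [u] except the [k]-th. *)
have [[k fk]|fk] := pselect (exists k, f (e2 k) != 0).
  have uk : u = c2 k u *: e2 k.
    apply/eqP; rewrite -subr_eq0; apply/eqP/(coord_separates ec2) => j.
    rewrite (coordD ec2) (coordN ec2) (coordZ ec2).
    have [->|jk] := eqVneq j k; first by rewrite (coord_ee ec2) mulr1 subrr.
    rewrite (coord_ne ec2)// mulr0 subr0.
    by move/eqP: (offdiag j k jk); rewrite mulf_eq0 (negbTE fk) => /eqP.
  exists (c2 k u), k; split => //.
  by have := nu; rewrite {1}uk nrZ (coord_norm1 ec2) mulr1.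
have f0 k : f (e2 k) = 0.
  by apply/eqP/negPn/negP => h; apply: fk; exists k.
have fsum n : f (\sum_(k < n) c2 k u *: e2 k) = 0.
  elim: n => [|n IH]; first by rewrite big_ord0 /f K0 (coord0 ec1).
  by rewrite big_ord_recr/= fD IH fZ f0 mulr0 addr0.
have u0 : u = 0.
  apply: (coord_total ec2) => n; apply: le_trans (coord_flip ec2 u n).
  set s := \sum_(k < n) _.
  have := hQ (-1) (2 *: s - u); rewrite cmodN cmod1 => /(_ erefl).
  have -> : Q (2 *: s - u) = - u.
    rewrite /Q fD fZ fsum mulr0 add0r -scaleN1r fZ /f JK (coord_ee ec1).
    by rewrite mulr1 scaleN1r.
  rewrite -opprD -mulr2n scaleNr scalerN opprK -addrA.
  rewrite [- u + _](_ : _ = u); last by rewrite scaler_nat mulr2n addKr.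
  by rewrite addrC => h; rewrite (le_trans h)// nr_dist.
by move: nu; rewrite u0 nr0 => /eqP; rewrite eq_sym oner_eq0.
Qed.

End Isometries.

(** The isometry and its inverse both send basis vectors to unimodular multiples of basis vectors;
    composing them in either order shows that the two index maps are mutually inverse. *)
Lemma isometry_signed_permutation (R : realType) (V W : normedModType R[i])
    (e1 : nat -> V) (c1 : nat -> V -> R[i]) (e2 : nat -> W) (c2 : nat -> W -> R[i])
    (J : V -> W) :
  coord_system e1 c1 -> coord_system e2 c2 ->
  (forall j k, j <> k -> ~ span_is_l22 (e1 j) (e1 k)) ->
  (forall j k, j <> k -> ~ span_is_l22 (e2 j) (e2 k)) ->
  linear_isometry J ->
  exists (w : nat -> R[i]) (p q : nat -> nat),
    [/\ forall i, `|w i| = 1, cancel p q, cancel q p &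
        forall i, J (e1 i) = w i *: e2 (p i)].
Proof.
move=> ec1 ec2 nl1 nl2 iJ; have [K [iK JK KJ]] := linear_isometry_inverse iJ.
have /choice[wp Jwp] i : exists wp, cmod wp.1 = 1 /\ J (e1 i) = wp.1 *: e2 wp.2.
  by have [w [k ?]] := isometry_basis_vector ec1 ec2 i nl2 iJ; exists (w, k).
have /choice[zq Kzq] k : exists zq, cmod zq.1 = 1 /\ K (e2 k) = zq.1 *: e1 zq.2.
  by have [w [i ?]] := isometry_basis_vector ec2 ec1 k nl1 iK; exists (w, i).
have scal (V' W' : normedModType R[i]) (T : V' -> W') (a : R[i]) x :
    linear_isometry T -> T (a *: x) = a *: T x.
  move=> [Tlin _ _]; have TD y z : T (y + z) = T y + T z by rewrite -[y]scale1r Tlin !scale1r.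
  have T0 : T 0 = 0 by apply: (addrI (T 0)); rewrite -TD !addr0.
  by rewrite -[a *: x]addr0 Tlin T0 addr0.
exists (fun i => (wp i).1), (fun i => (wp i).2), (fun k => (zq k).2); split.
- by move=> i; apply/cmod_eq1; case: (Jwp i).
- move=> i; apply/eqP/negPn/negP => ne.
  have := coord_ee ec1 i; rewrite -(JK (e1 i)) (Jwp i).2 scal// (Kzq _).2.
  rewrite scalerA (coordZ ec1) (coord_ne ec1) ?mulr0; last by rewrite eq_sym.
  by move/eqP; rewrite eq_sym oner_eq0.
- move=> k; apply/eqP/negPn/negP => ne.
  have := coord_ee ec2 k; rewrite -(KJ (e2 k)) (Kzq k).2 scal// (Jwp _).2.
  rewrite scalerA (coordZ ec2) (coord_ne ec2) ?mulr0; last by rewrite eq_sym.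
  by move/eqP; rewrite eq_sym oner_eq0.
- by move=> i; case: (Jwp i).
Qed.

(** * Coordinates in the completion of c00 *)

Section FiniteCombinations.
Variable R : realType.
Implicit Types (V : normedModType R[i]) (x y : {fsfun nat -> R[i] with 0}).

Lemma lincomb_widen V (e : nat -> V) x (D : {fset nat}) :
  (forall i, i \notin D -> x i = 0) -> lincomb e x = \sum_(i <- D) x i *: e i.
Proof.
move=> xD; rewrite /lincomb.
rewrite [RHS](bigID (mem (finsupp x)) xpredT)/= [X in _ = _ + X]big1 ?addr0; last first.
  by move=> i; rewrite memNfinsupp => /eqP ->; rewrite scale0r.
rewrite -[RHS]big_filter; apply: perm_big; apply: uniq_perm.
- exact: fset_uniq.
- by rewrite filter_uniq// fset_uniq.
move=> i; rewrite mem_filter/=; have [ix|//] := boolP (i \in finsupp x).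
by apply/esym/negPn/negP => /xD/eqP; apply/negP; rewrite -mem_finsupp.
Qed.

Definition fs_restr (D : {fset nat}) (a : nat -> R[i]) : {fsfun nat -> R[i] with 0} :=
  [fsfun i in D => a i].

Lemma fs_restrE D a i : fs_restr D a i = if i \in D then a i else 0.
Proof. by rewrite fsfunE. Qed.

Lemma lincomb_restr V (e : nat -> V) D a :
  lincomb e (fs_restr D a) = \sum_(i <- D) a i *: e i.
Proof.
rewrite (@lincomb_widen _ e _ D); last by move=> i /negbTE; rewrite fs_restrE => ->.
by apply: eq_big_seq => i iD; rewrite fs_restrE iD.
Qed.

Lemma big_ord_fset V n (F : nat -> V) :
  \sum_(i < n) F i = \sum_(i <- [fset i in iota 0 n]%fset) F i.
Proof.
rewrite -(big_mkord xpredT F) /index_iota subn0; apply: perm_big; apply: uniq_perm.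
- exact: iota_uniq.
- exact: fset_uniq.
by move=> i; rewrite inE.
Qed.

Definition fs_comb (a : R[i]) x y : {fsfun nat -> R[i] with 0} :=
  fs_restr (finsupp x `|` finsupp y)%fset (fun i => a * x i + y i).

Lemma fs_combE a x y i : fs_comb a x y i = a * x i + y i.
Proof.
rewrite fs_restrE inE !mem_finsupp.
by case: eqVneq => [->|//]; case: eqVneq => [->|//]; rewrite mulr0 addr0.
Qed.

Lemma lincomb_comb V (e : nat -> V) a x y :
  lincomb e (fs_comb a x y) = a *: lincomb e x + lincomb e y.
Proof.
rewrite lincomb_restr scaler_sumr.
rewrite [in RHS](@lincomb_widen _ e y (finsupp x `|` finsupp y)%fset); last first.
  by move=> i; rewrite inE negb_or => /andP[_]; rewrite memNfinsupp => /eqP.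
have -> : \sum_(i <- finsupp x) a *: (x i *: e i) = a *: lincomb e x.
  by rewrite /lincomb scaler_sumr.
rewrite (@lincomb_widen _ e x (finsupp x `|` finsupp y)%fset); last first.
  by move=> i; rewrite inE negb_or => /andP[+ _]; rewrite memNfinsupp => /eqP.
by rewrite scaler_sumr -big_split/=; apply: eq_bigr => i _; rewrite scalerDl scalerA.
Qed.

Lemma unconditional_fset V (e : nat -> V) (D D' : {fset nat}) (a a' : nat -> R[i]) :
  unconditional1 e -> (forall i, i \in D -> i \in D' /\ cmod (a i) <= cmod (a' i)) ->
  nr (\sum_(i <- D) a i *: e i) <= nr (\sum_(i <- D') a' i *: e i).
Proof.
move=> eU H; rewrite -nr_le -!lincomb_restr; apply: eU => i.
rewrite !fs_restrE; have [iD|_] := boolP (i \in D); last by rewrite normr0.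
by have [-> h] := H i iD; rewrite -!cmodE lecR.
Qed.

End FiniteCombinations.

(** The supremum of the lower bounds [g s - d s] works. This gives a limit value by density without
    choosing a Cauchy sequence. *)
Lemma exists_between (R : realType) (T : Type) (t0 : T) (g d : T -> R) :
  (forall s t, g s - g t <= d s + d t) -> exists r, forall t, `|r - g t| <= d t.
Proof.
move=> H; pose S := [set g s - d s | s in [set: T]].
have S0 : S !=set0 by exists (g t0 - d t0), t0.
have Sub t : ubound S (g t + d t).
  by move=> _ [s _ <-]; have := H s t; lra.
exists (sup S) => t; rewrite ler_norml; apply/andP; split.
  have : g t - d t <= sup S by apply: ub_le_sup; [exists (g t + d t)|exists t].
  by lra.
by have := ge_sup S0 (Sub t); lra.
Qed.

(** * Extension of the coordinates from finite combinations by density *)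

Section CoordinatesOfUnconditionalBasis.
Variables (R : realType) (V : normedModType R[i]) (e : nat -> V).
Hypotheses (eU : unconditional1 e) (e1 : normalized_seq e).
Hypothesis eD : dense (range (lincomb e)).

Lemma dense_lincomb v (r : R) : 0 < r -> exists x, nr (v - lincomb e x) < r.
Proof.
move=> r0; have ne : ball v r%:C !=set0 by exists v; apply: ballxx; rewrite ltcR.
have [y [vy [x _ xE]]] := eD ne (ball_open _ _).
by exists x; rewrite -ltcR nrE xE; move: vy; rewrite -ball_normE.
Qed.

Lemma cmod_le_lincomb (x : {fsfun nat -> R[i] with 0}) i : cmod (x i) <= nr (lincomb e x).
Proof.
have -> : cmod (x i) = nr (\sum_(k <- [fset i]%fset) x k *: e k).
  by rewrite big_seq_fset1 nrZ /nr e1 mulr1.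
apply: le_trans (_ : nr (\sum_(k <- (i |` finsupp x)%fset) x k *: e k) <= _).
  by apply: unconditional_fset => // k; rewrite inE => /eqP->; rewrite !inE eqxx.
rewrite -(@lincomb_widen _ _ e)// => k.
by rewrite !inE negb_or => /andP[_]; rewrite memNfinsupp => /eqP.
Qed.

(** On finite combinations the [i]-th coordinate is 1-Lipschitz, so [exists_between] applies to its
    real and imaginary parts; adding the two errors gives the factor 2. *)
Lemma approx_coordinate i v :
  exists a : R[i], forall x : {fsfun nat -> R[i] with 0},
    cmod (a - x i) <= 2 * nr (v - lincomb e x).
Proof.
have key (p q : {fsfun nat -> R[i] with 0}) :
    cmod (p i - q i) <= nr (v - lincomb e p) + nr (v - lincomb e q).
  have -> : p i - q i = fs_comb (-1) q p i by rewrite fs_combE mulN1r addrC.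
  apply: le_trans (cmod_le_lincomb _ _) _; rewrite lincomb_comb scaleN1r.
  rewrite (_ : - _ + _ = (v - lincomb e q) - (v - lincomb e p)).
    by rewrite [leRHS]addrC nrB.
  by rewrite opprB [RHS]addrC addrA subrK addrC.
have keyR (x y : {fsfun nat -> R[i] with 0}) :
    complex.Re (x i) - complex.Re (y i) <= nr (v - lincomb e x) + nr (v - lincomb e y).
  apply: le_trans (key x y); apply: le_trans (le_trans (ler_norm _) (Re_le_cmod _)).
  by case: (x i) (y i) => [? ?] [? ?].
have keyI (x y : {fsfun nat -> R[i] with 0}) :
    complex.Im (x i) - complex.Im (y i) <= nr (v - lincomb e x) + nr (v - lincomb e y).
  apply: le_trans (key x y); rewrite -[cmod _]mul1r -cmod_i -cmodM -cmodN.
  apply: le_trans (le_trans (ler_norm _) (Re_le_cmod _)).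
  by case: (x i) (y i) => [? ?] [? ?]; simpc.
have [p hp] := exists_between (fs_restr fset0 (fun=> 0)) keyR.
have [q hq] := exists_between (fs_restr fset0 (fun=> 0)) keyI.
exists (p +i* q) => x; rewrite mulr_natl mulr2n.
have -> : p +i* q - x i = (p - complex.Re (x i))%:C + 'i * (q - complex.Im (x i))%:C.
  by case: (x i) => ? ?; simpc.
by apply: le_trans (cmodD _ _) _; rewrite cmodM cmod_i mul1r !cmodR lerD.
Qed.

(** The crude bound [K] only controls the error of approximating [v] by a finite combination; the
    sharp constant 1 comes from the dense subspace. *)
Lemma contraction_of_dense (T : V -> V) (K : R) : 0 <= K ->
  {morph T : x y / x + y} -> (forall v, nr (T v) <= K * nr v) ->
  (forall x, nr (T (lincomb e x)) <= nr (lincomb e x)) ->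
  forall v, nr (T v) <= nr v.
Proof.
move=> K0 TD TK TC v; apply/ler_addgt0Pr => r r0.
have r'0 : 0 < r / (K + 1) by rewrite divr_gt0//; lra.
have [x hx] := dense_lincomb v r'0.
have -> : T v = T (v - lincomb e x) + T (lincomb e x) by rewrite -TD subrK.
apply: le_trans (nrD _ _) _; have h1 := TC x; have h2 := TK (v - lincomb e x).
have h3 : nr (lincomb e x) <= nr v + nr (v - lincomb e x).
  by rewrite -{1}(subKr v (lincomb e x)) nrB.
have : (K + 1) * nr (v - lincomb e x) <= r.
  by rewrite -ler_pdivlMl ?ltW// 1?mulrC//; lra.
by rewrite mulrDl mul1r; lra.
Qed.

(** Each norm inequality holds on finite combinations by unconditionality and extends through
    [contraction_of_dense]. The two extra conclusions, contractive projections and convergent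
    partial sums, serve the dual case. *)
Lemma exists_coord_system : exists c, [/\ coord_system e c,
  forall v (D : {fset nat}), nr (\sum_(i <- D) c i v *: e i) <= nr v &
  forall v (r : R), 0 < r ->
    exists N, forall n, (N <= n)%N -> nr (v - \sum_(i < n) c i v *: e i) <= r].
Proof.
have /choice[c0 c0P] : forall iv : nat * V, exists a : R[i],
    forall x : {fsfun nat -> R[i] with 0}, cmod (a - x iv.1) <= 2 * nr (iv.2 - lincomb e x).
  by move=> [i v]; apply: approx_coordinate.
pose c i v := c0 (i, v).
have cP i v (x : {fsfun nat -> R[i] with 0}) :
    cmod (c i v - x i) <= 2 * nr (v - lincomb e x) := c0P (i, v) x.
have cl i x : c i (lincomb e x) = x i.
  apply/eqP; rewrite -subr_eq0 -cmod_eq0; apply/eqP/le_anti; rewrite cmod_ge0 andbT.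
  by have := cP i (lincomb e x) x; rewrite subrr nr0 mulr0.
have cl' i (D : {fset nat}) (a : nat -> R[i]) :
    c i (\sum_(k <- D) a k *: e k) = if i \in D then a i else 0.
  by rewrite -lincomb_restr cl fs_restrE.
have clin i a x y : c i (a *: x + y) = a * c i x + c i y.
  apply/eqP; rewrite -subr_eq0 -cmod_eq0; apply/eqP/le_anti; rewrite cmod_ge0 andbT.
  apply/ler_addgt0Pr => r r0; rewrite add0r.
  have r'0 : 0 < r / (4 * (cmod a + 1)).
    (* With both approximations within [s], the defect of linearity is at most
       [2 * (cmod a + 1) * s] from the combination plus as much from [x] and [y] separately. *)
    by rewrite divr_gt0// mulr_gt0// ltr_wpDl ?cmod_ge0.
  have [p hp] := dense_lincomb x r'0; have [q hq] := dense_lincomb y r'0.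
  set s := r / _ in r'0 hp hq.
  have rs : r = 4 * (cmod a + 1) * s.
    by rewrite /s mulrCA divff ?mulr1// gt_eqF// mulr_gt0// ltr_wpDl ?cmod_ge0.
  have h1 := cP i x p; have h2 := cP i y q.
  have h3 := cP i (a *: x + y) (fs_comb a p q).
  have h4 : nr (a *: x + y - lincomb e (fs_comb a p q)) <= cmod a * s + s.
    rewrite lincomb_comb opprD addrACA -scalerBr; apply: le_trans (nrD _ _) _.
    by rewrite nrZ lerD ?ler_wpM2l ?cmod_ge0// ltW.
  have -> : c i (a *: x + y) - (a * c i x + c i y) =
      (c i (a *: x + y) - fs_comb a p q i) + (a * (p i - c i x) + (q i - c i y)).
    by rewrite fs_combE; ring.
  apply: le_trans (cmodD _ _) _.
  apply: le_trans (lerD (lexx _) (cmodD _ _)) _; rewrite cmodM !(cmodB _ (c i _)).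
  have h5 : cmod a * cmod (c i x - p i) <= cmod a * (2 * s).
    by rewrite ler_wpM2l ?cmod_ge0//; lra.
  by rewrite rs; lra.
have cD i x y : c i (x + y) = c i x + c i y by rewrite -[x]scale1r clin mul1r scale1r.
have cb i v : cmod (c i v) <= 2 * nr v.
  have := cP i v (fs_restr fset0 (fun=> 0)).
  by rewrite lincomb_restr big_seq_fset0 subr0 fs_restrE/= subr0.
have ce i j : c i (e j) = (i == j)%:R.
  have := cl' i [fset j]%fset (fun=> 1); rewrite big_seq_fset1 scale1r => ->.
  by rewrite inE; case: eqP.
have cn v (D : {fset nat}) : nr (\sum_(i <- D) c i v *: e i) <= nr v.
  apply: (@contraction_of_dense (fun v => \sum_(i <- D) c i v *: e i) (#|` D|%:R * 2)).
  - by rewrite mulr_ge0.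
  - by move=> x y /=; rewrite -big_split; apply: eq_bigr => i _; rewrite cD scalerDl.
  - move=> x; apply: le_trans (nr_sum _ _ _) _.
    apply: (@le_trans _ _ (\sum_(i <- D) 2 * nr x)).
      by apply: ler_sum => i _; rewrite nrZ [nr (e _)]/nr e1 mulr1.
    by rewrite big_const_seq count_predT iter_addr_0 -[leLHS]mulr_natl mulrA.
  - move=> x; rewrite -lincomb_restr -nr_le; apply: eU => i.
    by rewrite fs_restrE cl; case: ifP; rewrite ?normr0.
have cconv v (r : R) : 0 < r ->
    exists N, forall n, (N <= n)%N -> nr (v - \sum_(i < n) c i v *: e i) <= r.
  move=> r0; have r'0 : 0 < r / 2 by rewrite divr_gt0.
  have [x hx] := dense_lincomb v r'0.
  (* From this index on, the indices below [n] contain the support of [x], so [lincomb e x] is its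
     own partial sum and only the small remainder is truncated. *)
  exists (\max_(i <- finsupp x) i.+1)%N => n hn.
  have xn : lincomb e x = \sum_(i < n) c i (lincomb e x) *: e i.
    rewrite (big_ord_fset n (fun i => c i (lincomb e x) *: e i)).
    rewrite {1}(@lincomb_widen _ _ e _ [fset i in iota 0 n]%fset).
      by apply: eq_bigr => i _; rewrite cl.
    move=> i; rewrite inE mem_iota add0n/= -leqNgt => ni.
    apply/eqP; rewrite -memNfinsupp; apply/negP => ix.
    have := leq_trans (@leq_bigmax_seq _ _ xpredT (fun i => i.+1) _ ix isT) (leq_trans hn ni).
    by rewrite ltnn.
  have -> : v - \sum_(i < n) c i v *: e i =
      (v - lincomb e x) - \sum_(i < n) c i (v - lincomb e x) *: e i.
    have -> : \sum_(i < n) c i v *: e i =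
        \sum_(i < n) c i (v - lincomb e x) *: e i + lincomb e x.
      rewrite {2}xn -big_split; apply: eq_bigr => i _ /=.
      by rewrite -scalerDl -cD subrK.
    by rewrite opprD addrA addrAC.
  rewrite (big_ord_fset n (fun i => c i (v - lincomb e x) *: e i)).
  apply: le_trans (nrB _ _) _.
  by have := cn (v - lincomb e x) [fset i in iota 0 n]%fset; lra.
exists c; split=> //; split=> //.
- by move=> i; rewrite /nr e1.
- move=> j k x jk.
  apply: (@contraction_of_dense (fun x => c j x *: e j + c k x *: e k) 4) => //.
  - by move=> y z; rewrite !cD !scalerDl addrACA.
  - move=> y; apply: le_trans (nrD _ _) _; rewrite !nrZ /nr !e1 !mulr1 -!/(nr _).
    by have := cb j y; have := cb k y; lra.
  - move=> y; rewrite !cl.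
    have -> : y j *: e j + y k *: e k = lincomb e (fs_restr [fset j; k]%fset y).
      by rewrite lincomb_restr big_fsetU1/= ?big_seq_fset1// inE.
    by rewrite -nr_le; apply: eU => i; rewrite fs_restrE; case: ifP; rewrite ?normr0.
- move=> w i x w1.
  apply: (@contraction_of_dense (fun x => x + ((w - 1) * c i x) *: e i) 5) => //.
  - by move=> y z; rewrite !cD mulrDr scalerDl addrACA.
  - move=> y; apply: le_trans (nrD _ _) _; rewrite !nrZ [nr (e i)]/nr e1 mulr1 cmodM.
    have h1 : cmod (w - 1) <= 2 by have := cmodD w (-1); rewrite cmodN cmod1 w1; lra.
    have h2 : cmod (w - 1) * cmod (c i y) <= 2 * (2 * nr y).
      by rewrite ler_pM ?cmod_ge0.
    by lra.
  - move=> y; rewrite cl.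
    have -> : lincomb e y + ((w - 1) * y i) *: e i =
        lincomb e (fs_comb ((w - 1) * y i) (fs_restr [fset i]%fset (fun=> 1)) y).
      by rewrite lincomb_comb lincomb_restr big_seq_fset1 scale1r addrC.
    rewrite -nr_le; apply: eU => k; rewrite fs_combE fs_restrE inE.
    case: eqVneq => [->|_]; last by rewrite mulr0 add0r.
    by rewrite mulr1 mulrBl mul1r subrK normrM (cmod_eq1 w).2// mul1r.
(* As [3 x = (x + 2 s) + 2 (x - s)] for a partial sum [s] within [r] of [x], one gets
   [3 * nr x <= nr x + 2 * r]. *)
- move=> x hx; apply: nr0_eq0; apply/le_anti; rewrite nr_ge0 andbT.
  apply/ler_addgt0Pr => r r0; rewrite add0r.
  have [N /(_ N (leqnn _)) hN] := cconv x r r0.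
  have := hx N; set s := \sum_(i < N) _ in hN * => h1.
  have := nrD (x + 2 *: s) (2 *: (x - s)).
  have -> : x + 2 *: s + 2 *: (x - s) = 3 *: x.
    rewrite scalerBr addrACA subrr addr0 -{1}[x]scale1r -scalerDl.
    by congr (_ *: _); ring.
  have cm k : cmod k%:R = k%:R :> R by rewrite -(rmorph_nat (@real_complex R)) cmodR ger0_norm.
  by rewrite !nrZ !cm; lra.
Qed.

End CoordinatesOfUnconditionalBasis.

(** * The norm of the completion attached to a family *)

Section CompletionForFamily.
Variables (R : realType) (E : normedModType R[i]) (F : set {fset nat}) (b : nat -> E).
Variables (X : completeNormedModType R[i]) (e : nat -> X).
Hypotheses (b1 : normalized_seq b) (bU : unconditional1 b) (FC : combinatorial F).
Hypothesis XF : is_X_FE F b e.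
Implicit Types (x y : {fsfun nat -> R[i] with 0}) (A D : {fset nat}).

Lemma X_FE_has_sup x :
  has_sup [set complex.Re `|\sum_(i <- A) x i *: b i| | A in F].
Proof.
split.
  exists (complex.Re `|\sum_(i <- [fset 0%N]%fset) x i *: b i|), [fset 0%N]%fset => //.
  exact: FC.1.
exists (nr (lincomb b x)) => _ [A _ <-].
rewrite -lincomb_restr -lecR nrE Re_normK; apply: bU => i.
by rewrite fs_restrE; case: ifP; rewrite ?normr0.
Qed.

Lemma nr_X_FE x :
  nr (lincomb e x) = sup [set complex.Re `|\sum_(i <- A) x i *: b i| | A in F].
Proof. by rewrite /nr XF.1. Qed.

Lemma nr_X_FE_ge x A : F A -> nr (\sum_(i <- A) x i *: b i) <= nr (lincomb e x).
Proof.
by move=> FA; rewrite nr_X_FE; apply: ub_le_sup; [exact: (X_FE_has_sup x).2|exists A].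
Qed.

Lemma nr_X_FE_le x (M : R) :
  (forall A, F A -> nr (\sum_(i <- A) x i *: b i) <= M) -> nr (lincomb e x) <= M.
Proof.
move=> H; rewrite nr_X_FE; apply: ge_sup; first exact: (X_FE_has_sup x).1.
by move=> _ [A FA <-]; apply: H.
Qed.

Lemma nr_X_FE_le_E x : nr (lincomb e x) <= nr (lincomb b x).
Proof.
apply: nr_X_FE_le => A FA; rewrite -lincomb_restr -nr_le; apply: bU => i.
by rewrite fs_restrE; case: ifP; rewrite ?normr0.
Qed.

Lemma nr_X_FE_sum_le D (a : nat -> R[i]) :
  nr (\sum_(i <- D) a i *: e i) <= nr (\sum_(i <- D) a i *: b i).
Proof. by rewrite -!lincomb_restr nr_X_FE_le_E. Qed.

Lemma nr_X_FE_sum D (a : nat -> R[i]) : F D ->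
  nr (\sum_(i <- D) a i *: e i) = nr (\sum_(i <- D) a i *: b i).
Proof.
move=> FD; apply/le_anti; rewrite nr_X_FE_sum_le/=.
rewrite -(lincomb_restr e); apply: le_trans (nr_X_FE_ge _ FD).
rewrite le_eqVlt; apply/orP; left; apply/eqP; congr nr.
by apply: eq_big_seq => i iD; rewrite fs_restrE iD.
Qed.

Lemma X_FE_unconditional : unconditional1 e.
Proof.
move=> x y xy; rewrite nr_le; apply: nr_X_FE_le => A FA.
apply: le_trans (nr_X_FE_ge _ FA).
by apply: unconditional_fset => // i iA; split=> //; rewrite -lecR !cmodE.
Qed.

Lemma X_FE_normalized : normalized_seq e.
Proof.
move=> i; rewrite -nrE.
have := nr_X_FE_sum (fun=> 1) (FC.1 i); rewrite !big_seq_fset1 !scale1r => ->.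
by rewrite nrE b1.
Qed.

(** If the pair belongs to [F], its span carries the norm of [E]. Otherwise each member of [F] meets
    the pair in at most one point, so [e j + e k] has norm at most 1, whereas [l_2^2] would give the
    square root of 2. *)
Lemma X_FE_not_l22 :
  (forall j k, j <> k -> ~ span_is_l22 (b j) (b k)) ->
  forall j k, j <> k -> ~ span_is_l22 (e j) (e k).
Proof.
move=> nl22 j k jk H.
have jNk : j \notin [fset k]%fset by rewrite inE; apply/eqP.
have pairE (W : normedModType R[i]) (f : nat -> W) (a c : R[i]) :
    a *: f j + c *: f k = \sum_(i <- [fset j; k]%fset) (if i == j then a else c) *: f i.
  rewrite big_fsetU1//= big_seq_fset1 eqxx.
  by case: eqVneq => // kj; case: jk.
have [Fjk|Fjk] := pselect (F [fset j; k]%fset).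
  apply: (nl22 j k jk) => a c; rewrite -H; congr (_ ^+ 2).
  by rewrite -!nrE pairE -nr_X_FE_sum// -pairE.
have : nr (1 *: e j + 1 *: e k) <= 1.
  rewrite pairE -lincomb_restr; apply: nr_X_FE_le => A FA.
  have [i iA] : exists i, forall l, l \in A -> l \in [fset j; k]%fset -> l = i.
    have [jA|jA] := boolP (j \in A); [exists j|exists k] => l lA; rewrite !inE => /orP[]/eqP// lE.
      by case: Fjk; apply: FC.2 FA _; apply/fsubsetP => m; rewrite !inE => /orP[]/eqP->//; rewrite -lE.
    by move: jA; rewrite -lE lA.
  have <- : nr (b i) = 1 by rewrite /nr b1.
  have -> : b i = lincomb b (fs_restr [fset i]%fset (fun=> 1)).
    by rewrite lincomb_restr big_seq_fset1 scale1r.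
  rewrite -lincomb_restr -nr_le; apply: bU => l; rewrite !fs_restrE.
  have [lA|_] := boolP (l \in A); last by rewrite normr0.
  have [/(iA l lA) ->|_] := boolP (l \in [fset j; k]%fset); last by rewrite normr0.
  by rewrite inE eqxx if_same.
set z := (X in nr X) => z1; have : nr z ^+ 2 = 1 + 1.
  apply: (@complexI R); rewrite rmorphXn/= nrE H normr1 expr1n.
  by rewrite [RHS]rmorphD !rmorph1.
have := nr_ge0 z; nra.
Qed.

End CompletionForFamily.

(** * Families of finite sets *)

(** A single bound strictly below [M] survives a later supremum over the infinitely many members of
    a family. *)
Lemma exists_uniform_lt (R : realDomainType) (T : eqType) (s : seq T) (g : T -> R) (M : R) :
  (forall k, k \in s -> g k < M) -> exists2 M', M' < M & forall k, k \in s -> g k <= M'.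
Proof.
elim: s => [_|k s IH H]; first by exists (M - 1); rewrite ?gtrBl.
have [|M' M'M hM'] := IH; first by move=> l ls; apply: H; rewrite inE ls orbT.
exists (Num.max M' (g k)); first by rewrite gt_max M'M H// inE eqxx.
move=> l; rewrite inE le_max => /predU1P[->|/hM' ->//].
by rewrite lexx orbT.
Qed.

Section ImageOfFamily.
Variables (R : realType) (E : normedModType R[i]) (b : nat -> E) (F : set {fset nat}).
Variables (X : completeNormedModType R[i]) (e : nat -> X).
Hypotheses (bU : unconditional1 b) (bS : strictly_unconditional1 b).
Hypotheses (FC : combinatorial F) (XF : is_X_FE F b e).

Lemma nr_fsetD1_lt (A : {fset nat}) i : i \in A ->
  nr (\sum_(k <- (A `\ i)%fset) b k) < nr (\sum_(k <- A) b k).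
Proof.
move=> iA; have sumE (D : {fset nat}) : \sum_(k <- D) b k = lincomb b (fs_restr D (fun=> 1)).
  by rewrite lincomb_restr; apply: eq_bigr => k _; rewrite scale1r.
rewrite -ltcR !nrE !sumE; apply: bS => [k|].
  rewrite !fs_restrE !inE; case: (k \in A); rewrite ?andbF ?normr0// andbT.
  by case: ifP; rewrite ?normr0 ?normr1.
by exists i; rewrite !fs_restrE !inE eqxx iA/= normr0 normr1.
Qed.

(* If [p(A)] is not in [F], every member of [F] misses some [p i], [i] in [A];
   so the norm of the indicator of [p(A)] is attained after dropping a
   coordinate, against strict unconditionality. *)
Lemma image_in_family (p : nat -> nat) (A : {fset nat}) : injective p ->
  nr (\sum_(i <- A) b i) <= nr (\sum_(i <- A) e (p i)) ->
  (forall i, i \in A ->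
     nr (\sum_(k <- (A `\ i)%fset) e (p k)) <= nr (\sum_(k <- (A `\ i)%fset) b k)) ->
  F [fset p i | i in A]%fset.
Proof.
move=> pI H1 H2; apply: contrapT => nF.
have [M' M'lt M'ge] := exists_uniform_lt (@nr_fsetD1_lt A).
have : nr (\sum_(i <- A) e (p i)) <= M'.
  have sumE (W : normedModType R[i]) (f : nat -> W) (D : {fset nat}) :
      \sum_(i <- D) f (p i) = lincomb f (fs_restr [fset p i | i in D]%fset (fun=> 1)).
    rewrite lincomb_restr big_imfset/=; last by move=> k l _ _ /pI.
    by apply: eq_bigr => k _; rewrite scale1r.
  rewrite sumE; apply: (nr_X_FE_le bU FC XF) => B FB.
  have [i iA piB] : exists2 i, i \in A & p i \notin B.
    apply: contrapT => h; apply: nF; apply: FC.2 FB _.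
    apply/fsubsetP => _ /imfsetP[i iA ->]; apply/negPn/negP => piB.
    by apply: h; exists i.
  apply: le_trans (M'ge i iA); apply: le_trans (H2 i iA); rewrite sumE.
  apply: le_trans (nr_X_FE_ge bU FC XF _ FB).
  rewrite le_eqVlt; apply/orP; left; apply/eqP; congr nr.
  apply: eq_big_seq => k kB; congr (_ *: _); rewrite !fs_restrE; congr (if _ then _ else _).
  apply/imfsetP/imfsetP => -[l lA kE]; exists l => //=; move: lA; rewrite !inE => lA.
    by rewrite lA andbT; apply/eqP => li; move: piB; rewrite -li -kE kB.
  by case/andP: lA.
by move=> /(le_trans H1)/(fun h => le_lt_trans h M'lt); rewrite ltxx.
Qed.

End ImageOfFamily.

(** Reindexing through [q] turns the signs into coefficients along [e] itself, where
    unconditionality applies in both directions. *)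
Lemma nr_sum_unimodular (R : realType) (V : normedModType R[i]) (e : nat -> V)
    (p q : nat -> nat) (w : nat -> R[i]) (D : {fset nat}) :
  unconditional1 e -> cancel p q -> (forall i, cmod (w i) = 1) ->
  nr (\sum_(i <- D) w i *: e (p i)) = nr (\sum_(i <- D) e (p i)).
Proof.
move=> eU pK w1.
have sumE (a : nat -> R[i]) :
    \sum_(i <- D) a i *: e (p i) = \sum_(k <- [fset p i | i in D]%fset) a (q k) *: e k.
  rewrite big_imfset/=; last by move=> k l _ _ /(can_inj pK).
  by apply: eq_bigr => i _; rewrite pK.
have -> : \sum_(i <- D) e (p i) = \sum_(i <- D) 1 *: e (p i).
  by apply: eq_bigr => i _; rewrite scale1r.
rewrite !sumE; apply/le_anti/andP.
by split; apply: unconditional_fset => // k kD; rewrite w1 cmod1.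
Qed.

(** * Averages over cyclic permutations *)

Section Averaging.
Variables (R : realType) (E : normedModType R[i]) (b : nat -> E).
Hypothesis bsym : symmetric1 b.

Lemma linear_isometry_sum (V W : normedModType R[i]) (T : V -> W) :
  linear_isometry T -> forall (I : Type) (s : seq I) (a : I -> R[i]) (f : I -> V),
  T (\sum_(i <- s) a i *: f i) = \sum_(i <- s) a i *: T (f i).
Proof.
move=> [Tlin _ _] I s a f.
have T0 : T 0 = 0 by have := Tlin (-1) 0 0; rewrite scaler0 addr0 scaleN1r addNr.
by elim: s => [|i s IH]; rewrite ?big_nil// !big_cons Tlin IH.
Qed.

(** The orbit of [i] under [next s] is a rotation of the list [s]. *)
Lemma big_traject_next (V : zmodType) (f : nat -> V) (s : seq nat) i :
  uniq s -> i \in s ->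
  \sum_(k < size s) f (iter k (next s) i) = \sum_(j <- s) f j.
Proof.
move=> us is_; have [n s' rs] := rot_to is_.
have nE : next (rot n s) = next s by apply/funext => j; rewrite next_rot.
have : fcycle (next s) (rot n s) by rewrite -nE cycle_next// rot_uniq.
rewrite {1}rs /= rcons_path => /andP[/fpathE s'E _].
have sz : size s = (size s').+1 by rewrite -(size_rot n) rs.
have rE : rot n s = traject (next s) i (size s) by rewrite rs sz trajectS -s'E.
have -> : \sum_(j <- s) f j = \sum_(j <- rot n s) f j.
  by apply: perm_big; rewrite perm_sym perm_rot.
rewrite rE (big_nth i) size_traject big_mkord.
by apply: eq_bigr => k _; rewrite nth_traject.
Qed.

(* Averaging over the cyclic shifts of [A]. *)
Lemma average_le (A : {fset nat}) (z : nat -> R[i]) :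
  cmod (\sum_(i <- A) z i) * nr (\sum_(i <- A) b i) <=
  #|` A|%:R * nr (\sum_(i <- A) z i *: b i).
Proof.
pose s : seq nat := A.
have us : uniq s by exact: fset_uniq.
(* [next s] fixes every index outside [s], so it is a permutation of all indices and symmetry
   applies to it. *)
have nb : bijective (next s) by exists (prev s); [exact: prev_next|exact: next_prev].
have [T iT Tb] := bsym nb.
pose v := \sum_(i <- A) z i *: b i.
have iterT k : iter k T v = \sum_(i <- A) z i *: b (iter k (next s) i).
  elim: k => //= k ->; rewrite linear_isometry_sum//.
  by apply: eq_bigr => i _; rewrite Tb.
have niter k : nr (iter k T v) = nr v.
  by case: iT => _ Tn _; elim: k => //= k <-; rewrite /nr Tn.
(* Over a full cycle each [b i] visits every basis vector of [A] once, so the shifts of [v] add up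
   to the sum of the [z i] times the indicator of [A]. *)
have <- : nr (\sum_(k < size s) iter k T v) = cmod (\sum_(i <- A) z i) * nr (\sum_(i <- A) b i).
  rewrite -nrZ; congr nr; under eq_bigr do rewrite iterT; rewrite exchange_big/=.
  rewrite scaler_suml; apply: eq_big_seq => i iA.
  by rewrite -scaler_sumr big_traject_next.
apply: le_trans (nr_sum _ _ _) _; under eq_bigr do rewrite niter.
by rewrite sumr_const card_ord mulr_natl.
Qed.

End Averaging.

Lemma family_image_eq (F1 F2 : set {fset nat}) (p q : nat -> nat) :
  cancel p q -> cancel q p ->
  (forall A, F1 A -> F2 [fset p i | i in A]%fset) ->
  (forall A, F2 A -> F1 [fset q i | i in A]%fset) ->
  [set [fset p i | i in A]%fset | A in F1] = F2.
Proof.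
move=> pK qK H1 H2; apply/seteqP; split => [_ [A FA <-]|B FB]; first exact: H1.
exists [fset q i | i in B]%fset; first exact: H2.
apply/fsetP => k; apply/imfsetP/idP => [[_ /imfsetP[i iB ->] ->]|kB]; first by rewrite qK.
by exists (q k); rewrite ?qK//; apply/imfsetP; exists k.
Qed.

(** * Duality *)

Section DualCoordinates.
Variables (R : realType) (V : normedModType R[i]).
Variables (e : nat -> V) (c : nat -> V -> R[i]) (e' : nat -> dual_space V).
Hypothesis ec : coord_system e c.
Hypothesis e'c : forall i x, e' i x = c i x.
Hypothesis conv : forall v (r : R), 0 < r ->
  exists N, forall n, (N <= n)%N -> nr (v - \sum_(i < n) c i v *: e i) <= r.
Implicit Types (f g : dual_space V).

Lemma dual_le f x : cmod (f x) <= nr f * nr x.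
Proof.
have [x0|x0] := eqVneq (nr x) 0.
  by rewrite (nr0_eq0 x0) (linear0 f) cmod0 nr0 mulr0.
have xC : (nr x)%:C != 0 :> R[i] by rewrite -cmod_eq0 cmodR normr_eq0.
have h : (cmod (f ((nr x)^-1%:C *: x)))%:C <= dual_norm f.
  rewrite cmodE; apply: dual_norm_ub.
  by rewrite -nrE nrZ cmodR ger0_norm ?invr_ge0 ?nr_ge0// mulVf.
move: h; rewrite -[dual_norm f]/`|f| -nrE lecR linearZ/= cmodM cmodR.
rewrite ger0_norm ?invr_ge0 ?nr_ge0//.
by rewrite ler_pdivrMl ?lt_neqAle ?nr_ge0 1?eq_sym ?x0// mulrC.
Qed.

Lemma dual_nr_le f (M : R) : (forall x, nr x <= 1 -> cmod (f x) <= M) -> nr f <= M.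
Proof.
move=> H; rewrite -lecR nrE; apply: dual_norm_le => x x1.
have : cmod (f x) <= M by apply: H; rewrite -lecR nrE.
by rewrite -lecR cmodE.
Qed.

Lemma dualE a f g x : (a *: f + g) x = a * f x + g x.
Proof. by []. Qed.

Lemma dual_pairE a a' f g x : (a *: f + a' *: g) x = a * f x + a' * g x.
Proof. by []. Qed.

Lemma dual_sum (I : Type) (s : seq I) (a : I -> R[i]) (f : I -> dual_space V) x :
  (\sum_(i <- s) a i *: f i) x = \sum_(i <- s) a i * f i x.
Proof.
by elim: s => [|i s IH]; rewrite ?big_nil// !big_cons -IH.
Qed.

(** The vector [2 c_i(x) e_i] is the difference of [x] and its sign change at [i], both of norm at
    most [nr x]. *)
Lemma coord_le i x : cmod (c i x) <= nr x.
Proof.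
have cm2 : cmod 2 = 2 :> R by rewrite -(rmorph_nat (@real_complex R)) cmodR ger0_norm.
have := coord_rotation ec i x (w := -1); rewrite cmodN cmod1 => /(_ erefl) h.
have := nrB x (x + ((-1 - 1) * c i x) *: e i).
rewrite opprD addNKr -scaleNr nrZ (coord_norm1 ec) mulr1.
rewrite (_ : - _ = 2 * c i x); last by ring.
by rewrite cmodM cm2; lra.
Qed.

(** The projections and rotations of the dual are adjoints of those of [V], so their norm bounds
    transpose. Totality uses the convergence of the partial sums of each [x], on which functionals
    are evaluated. *)
Lemma dual_coord_system : coord_system e' (fun i f => f (e i)).
Proof.
have cm k : cmod k%:R = k%:R :> R by rewrite -(rmorph_nat (@real_complex R)) cmodR ger0_norm.
have linf f x y : f (x + y) = f x + f y by exact: (linearD f).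
have linZ f a x : f (a *: x) = a * f x by rewrite linearZ.
split=> //.
- by move=> i j; rewrite e'c (coord_basis ec) eq_sym.
- move=> i; apply/le_anti/andP; split.
    by apply: dual_nr_le => x x1; rewrite e'c (le_trans (coord_le i x)).
  by have := dual_le (e' i) (e i); rewrite e'c (coord_ee ec) cmod1 (coord_norm1 ec) mulr1.
- move=> j k f jk; apply: dual_nr_le => x x1.
  have -> : (f (e j) *: e' j + f (e k) *: e' k) x = f (c j x *: e j + c k x *: e k).
    rewrite dual_pairE linf !linZ -!e'c (mulrC (e' j x)) (mulrC (e' k x)); congr (_ + _).
  apply: le_trans (dual_le _ _) _.
  by rewrite ler_piMr ?nr_ge0// (le_trans (coord_pair ec _ jk)).
- move=> w i f w1; apply: dual_nr_le => x x1.
  have -> : (f + ((w - 1) * f (e i)) *: e' i) x = f (x + ((w - 1) * c i x) *: e i).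
    rewrite addrC dualE linf linZ e'c addrC; congr (_ + _); ring.
  apply: le_trans (dual_le _ _) _.
  by rewrite ler_piMr ?nr_ge0// (le_trans (coord_rotation ec _ _ w1)).
- move=> f H.
  (* For a partial sum [s] of [x], [3 f(x) = f(x + 2 s) + 2 f(x - s)]. The first term is the
     functional bounded by [H], evaluated at [x], and the second is at most [r] by the choice of
     [N]. *)
  have f3 x : 3 * cmod (f x) <= nr f * nr x.
    apply/ler_addgt0Pr => r r0.
    have r'0 : 0 < r / (2 * nr f + 1).
      by rewrite divr_gt0// ltr_wpDl// mulr_ge0 ?nr_ge0.
    have [N /(_ N (leqnn N)) hN] := conv x r'0.
    have := H N; set s := \sum_(i < N) c i x *: e i in hN.
    move=> /(fun h => le_trans (dual_le _ x) (ler_wpM2r (nr_ge0 x) h)).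
    have -> : (f + 2 *: \sum_(i < N) f (e i) *: e' i) x = f (x + 2 *: s).
      rewrite addrC dualE dual_sum linf linZ addrC; congr (_ + _ * _).
      rewrite /s; elim: N {hN s} => [|N IH]; first by rewrite !big_ord0 (linear0 f).
      by rewrite !big_ord_recr/= linf linZ IH e'c mulrC.
    have fs : 3 * f x = f (x + 2 *: s) + 2 * f (x - s).
      by rewrite !linf -scaleN1r !linZ; ring.
    have f3 : 3 * cmod (f x) <= cmod (f (x + 2 *: s)) + 2 * cmod (f (x - s)).
      by rewrite -!cm -!cmodM fs cmodD.
    have h1 := dual_le f (x - s).
    have h2 : nr f * nr (x - s) <= nr f * (r / (2 * nr f + 1)) by rewrite ler_wpM2l ?nr_ge0.
    have h3 : 2 * (nr f * (r / (2 * nr f + 1))) <= r.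
      rewrite !mulrA ler_pdivrMr; last by rewrite ltr_wpDl// mulr_ge0 ?nr_ge0.
      by rewrite mulrC ler_wpM2l ?(ltW r0)// lerDl.
    by move=> h4; lra.
  have nf : 3 * nr f <= nr f.
    rewrite -ler_pdivlMl//; apply: dual_nr_le => x x1.
    rewrite ler_pdivlMl//; apply: le_trans (f3 x) _.
    by rewrite ler_piMr ?nr_ge0.
  by apply: nr0_eq0; apply/le_anti; rewrite nr_ge0 andbT; lra.
Qed.

(* No Hahn-Banach is needed, since by strict
   convexity a point of the ball at which [s c_j + t c_k] is almost [1] is
   close to [s e_j + t e_k]. *)
Lemma span_is_l22_dual j k : j != k ->
  span_is_l22 (e' j) (e' k) -> span_is_l22 (e j) (e k).
Proof.
move=> jk; have kj : k != j by rewrite eq_sym.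
move=> /(span_is_l22_nr (coord_rotl dual_coord_system jk) (coord_rotr dual_coord_system jk)) H.
apply/(span_is_l22_nr (coord_rotl ec jk) (coord_rotr ec jk)).
set n := fun s t : R => nr (s%:C *: e j + t%:C *: e k).
(* Pairing the vector with the functional having the same coefficients gives
   [s ^+ 2 + t ^+ 2 <= m * n s t], where [m ^+ 2 = s ^+ 2 + t ^+ 2]. *)
have lower s t : 0 <= s -> 0 <= t -> s ^+ 2 + t ^+ 2 <= n s t ^+ 2.
  move=> s0 t0.
  have := dual_le (s%:C *: e' j + t%:C *: e' k) (s%:C *: e j + t%:C *: e k).
  rewrite dual_pairE !e'c !(coordD ec) !(coordZ ec) !(coord_ee ec) (coord_ne ec jk) (coord_ne ec kj).
  rewrite !mulr0 !mulr1 addr0 add0r -!rmorphM -rmorphD/= cmodR ger0_norm ?addr_ge0 ?mulr_ge0//.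
  rewrite -!expr2 => h.
  have := H s t s0 t0; move: h; set m := nr (_ *: e' j + _) => h m2.
  have [n0 m0] : 0 <= n s t /\ 0 <= m by rewrite !nr_ge0.
  move: h; rewrite -m2 -/(n s t) => h.
  have [->|mn] := eqVneq m 0; first by rewrite expr0n sqr_ge0.
  rewrite ler_sqr ?nnegrE//; rewrite -(@ler_pM2l _ m) -?expr2// lt_neqAle m0 eq_sym mn//.
have unit s t : 0 <= s -> 0 <= t -> s ^+ 2 + t ^+ 2 = 1 -> n s t <= 1.
  move=> s0 t0 st1; apply/ler_addgt0Pr => r r0.
  set f := s%:C *: e' j + t%:C *: e' k.
  have nf : nr f = 1.
    by apply/eqP; rewrite -(@pexpr_eq1 _ _ 2) ?nr_ge0// H// st1.
  have [x [x1 hx]] : exists x, nr x <= 1 /\ 1 - r ^+ 2 / 8 < cmod (f x).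
    apply: contrapT => no; have : nr f <= 1 - r ^+ 2 / 8.
      by apply: dual_nr_le => x x1; rewrite leNgt; apply/negP => h; apply: no; exists x.
    by rewrite nf; have := exprn_gt0 2 r0; lra.
  pose p := cmod (c j x); pose q := cmod (c k x).
  have np : n p q <= 1.
    apply: (le_trans _ x1); apply: (le_trans _ (coord_pair ec x jk)).
    by rewrite (nr_pairE (coord_rotl ec jk) (coord_rotr ec jk) (c j x)) lexx.
  have p0 : 0 <= p by exact: cmod_ge0.
  have q0 : 0 <= q by exact: cmod_ge0.
  have pq1 : p ^+ 2 + q ^+ 2 <= 1.
    by apply: le_trans (lower p q p0 q0) _; rewrite expr_le1// nr_ge0.
  have fx : cmod (f x) <= s * p + t * q.
    rewrite dual_pairE !e'c; apply: le_trans (cmodD _ _) _.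
    by rewrite !cmodM !cmodR !ger0_norm.
  (* Expanding, the left side is at most [2 - 2 * (s * p + t * q)], and
     [s * p + t * q > 1 - r ^+ 2 / 8]; this is why 8 was chosen. *)
  have d : (s - p) ^+ 2 + (t - q) ^+ 2 <= (r / 2) ^+ 2 by nra.
  have d1 : `|s - p| <= r / 2.
    by rewrite -ler_sqr ?nnegrE ?divr_ge0 ?(ltW r0)// real_normK ?num_real//; have := sqr_ge0 (t - q); lra.
  have d2 : `|t - q| <= r / 2.
    by rewrite -ler_sqr ?nnegrE ?divr_ge0 ?(ltW r0)// real_normK ?num_real//; have := sqr_ge0 (s - p); lra.
  have -> : n s t = nr ((p%:C *: e j + q%:C *: e k) + ((s - p)%:C *: e j + (t - q)%:C *: e k)).
    by rewrite addrACA -!scalerDl -!rmorphD/= !subrKC.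
  apply: le_trans (nrD _ _) _; rewrite -/(n p q).
  apply: le_trans (lerD np (nrD _ _)) _.
  by rewrite !nrZ !(coord_norm1 ec) !mulr1 !cmodR; lra.
move=> s t s0 t0; apply/le_anti; rewrite lower// andbT.
have [st0|st0] := eqVneq (s ^+ 2 + t ^+ 2) 0.
  have [s00 t00] : s = 0 /\ t = 0.
    by move/eqP: st0; rewrite paddr_eq0 ?sqr_ge0// !sqrf_eq0 => /andP[/eqP-> /eqP->].
  by rewrite /n s00 t00 !scale0r addr0 nr0 expr0n addr0.
pose m := Num.sqrt (s ^+ 2 + t ^+ 2).
have m2 : m ^+ 2 = s ^+ 2 + t ^+ 2 by rewrite sqr_sqrtr// addr_ge0 ?sqr_ge0.
have m0 : 0 < m by rewrite sqrtr_gt0 lt_neqAle eq_sym st0 addr_ge0 ?sqr_ge0.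
have : n (s / m) (t / m) <= 1.
  apply: unit; rewrite ?divr_ge0 ?(ltW m0)//.
  by rewrite !expr_div_n -mulrDl -m2 divff// expf_neq0// gt_eqF.
rewrite -/(n s t); have -> : n s t = m * n (s / m) (t / m).
  have mE (u : R) : m * (u / m) = u by rewrite mulrCA divff ?mulr1// gt_eqF.
  have cmE : cmod m%:C = m by rewrite cmodR ger0_norm// ltW.
  by rewrite -{1}cmE -nrZ scalerDr !scalerA -!rmorphM/= !mE.
rewrite -m2 => h; rewrite ler_sqr ?nnegrE ?mulr_ge0 ?nr_ge0 ?(ltW m0)//.
by rewrite ler_piMr// ltW.
Qed.

End DualCoordinates.

(** Apply [c k] to the partial sums of the expansion: beyond [k] they have [k]-th coordinate
    [e' k x], and [c k] is 1-Lipschitz by [coord_le]. *)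
Lemma coordinate_functionalsE (R : realType) (V : normedModType R[i]) (e : nat -> V)
    (c : nat -> V -> R[i]) (e' : nat -> dual_space V) :
  coord_system e c -> coordinate_functionals e e' -> forall i x, e' i x = c i x.
Proof.
move=> ec cf k x; apply/eqP; rewrite -subr_eq0 -cmod_eq0; apply/eqP/le_anti.
rewrite cmod_ge0 andbT; apply/ler_addgt0Pr => r r0; rewrite add0r.
have /cvgrPdist_lt /(_ r%:C) := cf x; rewrite ltcR => /(_ r0)[N _ hN].
(* The successor ensures that the term of index [k] belongs to the partial sum. *)
have /= := hN (maxn N k.+1) (leq_maxl _ _).
rewrite -nrE ltcR => /ltW; apply: le_trans.
apply: le_trans (coord_le ec k _).
rewrite seriesEnat/= big_mkord (coordD ec) (coordN ec).
rewrite (coord_partial_sum ec (e' ^~ x)) leq_max ltnSn orbT.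
by rewrite cmodB.
Qed.

(** * Compatibility of the permutation with the families *)

Lemma compatible_of_isometry (R : realType) (E : normedModType R[i]) (b : nat -> E)
    (F1 F2 : set {fset nat}) (X1 X2 : completeNormedModType R[i])
    (e1 : nat -> X1) (e2 : nat -> X2) (J : X1 -> X2) (w : nat -> R[i]) (p q : nat -> nat) :
  unconditional1 b -> strictly_unconditional1 b ->
  combinatorial F1 -> combinatorial F2 -> is_X_FE F1 b e1 -> is_X_FE F2 b e2 ->
  linear_isometry J -> (forall i, cmod (w i) = 1) -> cancel p q ->
  (forall i, J (e1 i) = w i *: e2 (p i)) ->
  forall A, F1 A -> F2 [fset p i | i in A]%fset.
Proof.
move=> bU bS F1C F2C X1F X2F iJ w1 pK Jw A FA.
have sum1 (W : normedModType R[i]) (f : nat -> W) (D : {fset nat}) :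
    \sum_(i <- D) f i = \sum_(i <- D) 1 *: f i.
  by apply: eq_bigr => i _; rewrite scale1r.
(* The signs do not affect the norm, so indicators keep their norm under [p]. In the first space
   that norm is the one of [E] when [D] is in [F1], and at most that one in general. *)
have nrJ (D : {fset nat}) : nr (\sum_(i <- D) e2 (p i)) = nr (\sum_(i <- D) e1 i).
  rewrite -(nr_sum_unimodular D (X_FE_unconditional bU F2C X2F) pK w1).
  have -> : \sum_(i <- D) w i *: e2 (p i) = J (\sum_(i <- D) e1 i).
    by rewrite (sum1 _ e1) (linear_isometry_sum iJ); apply: eq_bigr => i _; rewrite scale1r Jw.
  by case: iJ => _ Jn _; rewrite /nr Jn.
apply: (image_in_family bU bS F2C X2F (can_inj pK)).
  by rewrite nrJ (sum1 _ b) (sum1 _ e1) (nr_X_FE_sum bU F1C X1F).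
by move=> i iA; rewrite nrJ (sum1 _ b) (sum1 _ e1) (nr_X_FE_sum_le bU F1C X1F).
Qed.

(** The indicator functional [f] of [A] is bounded above by averaging, and its image is tested on a
    signed indicator of [p(A)]. Together, [nr f * N <= #|A| <= nr f * M], so that [N <= M]. *)
Lemma compatible_of_dual_isometry (R : realType) (E : normedModType R[i]) (b : nat -> E)
    (F1 F2 : set {fset nat}) (X1 X2 : completeNormedModType R[i])
    (e1 : nat -> X1) (c1 : nat -> X1 -> R[i]) (e1' : nat -> dual_space X1)
    (e2 : nat -> X2) (c2 : nat -> X2 -> R[i]) (e2' : nat -> dual_space X2)
    (J : dual_space X1 -> dual_space X2) (w : nat -> R[i]) (p q : nat -> nat) :
  unconditional1 b -> strictly_unconditional1 b -> symmetric1 b ->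
  combinatorial F1 -> combinatorial F2 -> is_X_FE F1 b e1 -> is_X_FE F2 b e2 ->
  (forall v (D : {fset nat}), nr (\sum_(i <- D) c1 i v *: e1 i) <= nr v) ->
  coord_system e2 c2 ->
  (forall i x, e1' i x = c1 i x) -> (forall i x, e2' i x = c2 i x) ->
  linear_isometry J -> (forall i, cmod (w i) = 1) -> cancel p q -> cancel q p ->
  (forall i, J (e1' i) = w i *: e2' (p i)) ->
  forall A, F1 A -> F2 [fset p i | i in A]%fset.
Proof.
move=> bU bS bsym F1C F2C X1F X2F c1le ec2 e1c e2c iJ w1 pK qK Jw A FA.
have sum1 (W : normedModType R[i]) (f : nat -> W) (D : {fset nat}) :
    \sum_(i <- D) f i = \sum_(i <- D) 1 *: f i.
  by apply: eq_bigr => i _; rewrite scale1r.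
have [T iT Tb] := bsym p (Bijective pK qK).
apply: (image_in_family bU bS F2C X2F (can_inj pK)); last first.
  (* The upper bounds on proper subsets come from symmetry alone: permuting by [p] keeps the norm in
     [E], which dominates that of the second space. *)
  move=> i iA; set D := (A `\ i)%fset.
  have <- : nr (\sum_(k <- D) b (p k)) = nr (\sum_(k <- D) b k).
    rewrite [in RHS]sum1; have [_ Tn _] := iT; rewrite -[RHS]/(complex.Re _) -Tn.
    rewrite (linear_isometry_sum iT); congr nr.
    by apply: eq_bigr => k _; rewrite Tb scale1r.
  have imE (W : normedModType R[i]) (f : nat -> W) :
      \sum_(k <- D) f (p k) = \sum_(l <- [fset p k | k in D]%fset) 1 *: f l.
    rewrite [RHS]big_imfset/=; last by move=> k l _ _; apply: (can_inj pK).
    by apply: eq_bigr => k _; rewrite scale1r.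
  by rewrite !imE (nr_X_FE_sum_le bU F2C X2F).
have [->|A0] := eqVneq A fset0; first by rewrite !big_seq_fset0 nr0 nr_ge0.
have cardA : 0 < #|` A|%:R :> R by rewrite ltr0n cardfs_gt0.
set N := nr (\sum_(i <- A) b i); set M := nr _.
pose f := \sum_(i <- A) 1 *: e1' i.
have fN : nr f * N <= #|` A|%:R.
  have [N0|N0] := eqVneq N 0; first by rewrite N0 mulr0 ltW.
  have Npos : 0 < N by rewrite lt_neqAle eq_sym N0 nr_ge0.
  rewrite -ler_pdivlMr//; apply: dual_nr_le => x x1; rewrite ler_pdivlMr//.
  have -> : f x = \sum_(i <- A) c1 i x.
    by rewrite /f dual_sum; apply: eq_bigr => i _; rewrite mul1r e1c.
  apply: le_trans (average_le bsym A (fun i => c1 i x)) _.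
  rewrite -(nr_X_FE_sum bU F1C X1F)// ler_piMr ?ler0n//.
  exact: le_trans (c1le x A) x1.
(* The inverse signs make every term of [J f x] equal to 1, and by unconditionality they leave the
   norm at [M]. *)
pose x := \sum_(i <- A) (w i)^-1 *: e2 (p i).
have nx : nr x = M.
  by apply: (nr_sum_unimodular A (X_FE_unconditional bU F2C X2F) pK) => i; rewrite cmodV w1 invr1.
have sum1r : \sum_(i <- A) (1 : R[i]) = #|` A|%:R.
  by rewrite big_const_seq count_predT iter_addr_0.
have Jfx : J f x = #|` A|%:R.
  rewrite /f (linear_isometry_sum iJ) dual_sum.
  rewrite -sum1r; apply: eq_big_seq => i iA; rewrite mul1r Jw.
  have -> : (w i *: e2' (p i)) x = w i * e2' (p i) x by [].
  rewrite e2c (coord_sum ec2) (bigD1_seq i)//= (coord_ee ec2) mulr1.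
  rewrite big1 => [|l li]; last by rewrite (coord_ne ec2) ?mulr0// (can_eq pK) eq_sym.
  by rewrite addr0 divff// -cmod_eq0 w1 oner_eq0.
have := dual_le (J f) x; rewrite Jfx nx -(rmorph_nat (@real_complex R)) cmodR ger0_norm//.
have -> : nr (J f) = nr f by case: iJ => _ Jn _; rewrite /nr Jn.
move=> h; have f0 : 0 < nr f.
  rewrite lt_neqAle nr_ge0 eq_sym andbT; apply/eqP => f0.
  by move: (lt_le_trans cardA h); rewrite f0 mul0r ltxx.
by rewrite -(ler_pM2l f0) (le_trans fN).
Qed.

Theorem corollary2p15 (R : realType)
    (E : completeNormedModType R[i]) (b : nat -> E)
    (b_basis : schauder_basis b) (b_norm1 : normalized_seq b)
    (b_uncond : unconditional1 b) (b_strict : strictly_unconditional1 b)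
    (b_not_l22 : forall j k : nat, j <> k -> ~ span_is_l22 (b j) (b k))
    (F1 F2 : set {fset nat})
    (F1_comb : combinatorial F1) (F2_comb : combinatorial F2)
    (X1 X2 : completeNormedModType R[i]) (e1 : nat -> X1) (e2 : nat -> X2)
    (X1_FE : is_X_FE F1 b e1) (X2_FE : is_X_FE F2 b e2) :
  (forall J : X1 -> X2, linear_isometry J ->
     compatible_signed_permutation F1 F2 e1 e2 J) /\
  (symmetric1 b ->
   (compact_family F1 /\ compact_family F2) \/ shrinking b ->
   forall (e1' : nat -> dual_space X1) (e2' : nat -> dual_space X2),
     coordinate_functionals e1 e1' -> coordinate_functionals e2 e2' ->
   forall J : dual_space X1 -> dual_space X2, linear_isometry J ->
     compatible_signed_permutation F1 F2 e1' e2' J).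
Proof.
have [c1 [ec1 c1le conv1]] := exists_coord_system (X_FE_unconditional b_uncond F1_comb X1_FE)
  (X_FE_normalized b_norm1 b_uncond F1_comb X1_FE) X1_FE.2.
have [c2 [ec2 c2le conv2]] := exists_coord_system (X_FE_unconditional b_uncond F2_comb X2_FE)
  (X_FE_normalized b_norm1 b_uncond F2_comb X2_FE) X2_FE.2.
have nl1 := X_FE_not_l22 b_norm1 b_uncond F1_comb X1_FE b_not_l22.
have nl2 := X_FE_not_l22 b_norm1 b_uncond F2_comb X2_FE b_not_l22.
(* The inverse isometry is a signed permutation along [q] with inverse signs, so the inclusion
   proved for [J] also holds backwards. *)
have inv (V W : normedModType R[i]) (J : V -> W) (K : W -> V) (f : nat -> V) (g : nat -> W)
    (w : nat -> R[i]) (p q : nat -> nat) :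
    linear_isometry K -> cancel J K -> cancel q p -> (forall i, cmod (w i) = 1) ->
    (forall i, J (f i) = w i *: g (p i)) ->
    (forall i, cmod (w (q i))^-1 = 1) /\ forall k, K (g k) = (w (q k))^-1 *: f (q k).
  move=> iK JK qK w1 Jw; split=> [i|k]; first by rewrite cmodV w1 invr1.
  have wk0 : w (q k) != 0 by rewrite -cmod_eq0 w1 oner_eq0.
  rewrite -[in RHS](JK (f (q k))) Jw qK.
  have := linear_isometry_sum iK [:: k] (fun=> w (q k)) g; rewrite !big_seq1 => ->.
  by rewrite scalerA mulVf// scale1r.
split=> [J iJ|bsym _ e1' e2' cf1 cf2 J iJ].
  have [w [p [q [w1 pK qK Jw]]]] := isometry_signed_permutation ec1 ec2 nl1 nl2 iJ.
  have cw i : cmod (w i) = 1 by apply/cmod_eq1.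
  have [K [iK JK KJ]] := linear_isometry_inverse iJ.
  have [cv Kv] := inv _ _ _ _ _ _ _ _ _ iK JK qK cw Jw.
  exists w, p; split => //; first by exists q.
  apply: (family_image_eq pK qK).
    exact: (compatible_of_isometry b_uncond b_strict F1_comb F2_comb X1_FE X2_FE iJ cw pK Jw).
  exact: (compatible_of_isometry b_uncond b_strict F2_comb F1_comb X2_FE X1_FE iK cv qK Kv).
(* The given functionals agree with the coordinates built by density, so both duals are coordinate
   systems. *)
have e1c := coordinate_functionalsE ec1 cf1; have e2c := coordinate_functionalsE ec2 cf2.
have ec1' := dual_coord_system ec1 e1c conv1; have ec2' := dual_coord_system ec2 e2c conv2.
have nl1' j k : j <> k -> ~ span_is_l22 (e1' j) (e1' k).
  by move=> /[dup] /eqP jk /nl1 + h; apply; apply: (span_is_l22_dual ec1 e1c conv1 jk).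
have nl2' j k : j <> k -> ~ span_is_l22 (e2' j) (e2' k).
  by move=> /[dup] /eqP jk /nl2 + h; apply; apply: (span_is_l22_dual ec2 e2c conv2 jk).
have [w [p [q [w1 pK qK Jw]]]] := isometry_signed_permutation ec1' ec2' nl1' nl2' iJ.
have cw i : cmod (w i) = 1 by apply/cmod_eq1.
have [K [iK JK KJ]] := linear_isometry_inverse iJ.
have [cv Kv] := inv _ _ _ _ _ _ _ _ _ iK JK qK cw Jw.
exists w, p; split => //; first by exists q.
apply: (family_image_eq pK qK).
  exact: (compatible_of_dual_isometry b_uncond b_strict bsym F1_comb F2_comb X1_FE X2_FE
    c1le ec2 e1c e2c iJ cw pK qK Jw).
exact: (compatible_of_dual_isometry b_uncond b_strict bsym F2_comb F1_comb X2_FE X1_FE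
    c2le ec1 e2c e1c iK cv qK pK Kv).
Qed.
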